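(* Let $\alpha>0$ and let $f:\mathbb{R}^n\to\mathbb{R}$ be a smooth function with minimum value $f^*$ such that, for constants $\ell_f,L_f\ge 0$, $\mu_f>0$, $H_f>0$ and all $x,y\in\mathbb{R}^n$, $$-\ell_f I_n\preceq\nabla^2 f(x)\preceq L_f I_n,\qquad \tfrac12\|\nabla f(x)\|^2\ge\mu_f\,(f(x)-f^* ),\qquad \|\nabla^2 f(x)-\nabla^2 f(y)\|\le H_f\|x-y\|.$$ Let the scalars $\underline{u}_{\mathbf I},\overline{u}_{\mathbf I},\beta_{\mathbf I}$ satisfy $$\underline{u}_{\mathbf I}<\alpha+\beta_{\mathbf I}^{-1}-L_f\beta_{\mathbf I},\qquad \overline{u}_{\mathbf I}>\alpha+\beta_{\mathbf I}^{-1}+\ell_f\beta_{\mathbf I},\qquad \alpha\le 2\mu_f\beta_{\mathbf I},$$ and consider the structure-$\mathbf I$ hybrid control system (defined in the context). Given the initial condition $\big(x_1(0),-\beta_{\mathbf I}\nabla f(x_1(0))\big)$, the time between two consecutive jumps of the solution trajectory, denoted by $\tau_{\mathbf I}$ (the time elapsed from the state $\big(x_1(0),-\beta_{\mathbf I}\nabla f(x_1(0))\big)$ until the next jump), satisfies, for any scalar $r>1$, $$\tau_{\mathbf I}\ \ge\ \log\left(\min\left\{\frac{a_1}{a_2+a_3\|\nabla f(x_1(0))\|}+1,\ r\right\}^{1/\delta}\right),$$ where $$C:=\frac{(\overline{u}_{\mathbf I}-\alpha)+\sqrt{(\overline{u}_{\mathbf I}-\alpha)^2+4L_f}}{2},\qquad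 \delta:=C+\max\{\overline{u}_{\mathbf I},-\underline{u}_{\mathbf I}\},\qquad \mathcal{L}_f:=\max\{\ell_f,L_f\},$$ $$a_1:=\min\big\{\overline{u}_{\mathbf I}-(\alpha+\beta_{\mathbf I}^{-1}+\ell_f\beta_{\mathbf I}),\ (\alpha+\beta_{\mathbf I}^{-1}-L_f\beta_{\mathbf I})-\underline{u}_{\mathbf I}\big\},$$ $$a_2:=rL_f\delta^{-1}(r\beta_{\mathbf I}C+1)+\beta_{\mathbf I}^{-1}+(r^2+r+1)\beta_{\mathbf I}\mathcal{L}_f,\qquad a_3:=r^3\beta_{\mathbf I}^2H_f\delta^{-1}.$$ Consequently, the solution trajectories are Zeno-free.
   Context: Smooth means (at least) twice differentiable; $\|\cdot\|$ is the Euclidean norm on vectors and the induced 2-norm on matrices. Structure-$\mathbf I$ hybrid control system: the state is $x=(x_1,x_2)\in\mathbb{R}^n\times\mathbb{R}^n$. The feedback law is $$u_{\mathbf I}(x)=\alpha+\frac{\|\nabla f(x_1)\|^2-\langle\nabla^2 f(x_1)x_2,x_2\rangle}{\langle\nabla f(x_1),-x_2\rangle}$$ (defined where the denominator is nonzero). The flow set is $\mathcal{C}_{\mathbf I}=\{x\in\mathbb{R}^{2n}: u_{\mathbf I}(x)\in[\underline{u}_{\mathbf I},\overline{u}_{\mathbf I}]\}$. While in the flow set, the state evolves continuously according to $$\dot x_1=x_2,\qquad \dot x_2=-\nabla f(x_1)-u_{\mathbf I}(x)\,x_2 .$$ As soon as the state reaches the boundary of $\mathcal{C}_{\mathbf I}$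 (otherwise than as an interior point of the flow set), it is instantaneously reset (a jump) by $x^+=G_{\mathbf I}(x)=(x_1,\,-\beta_{\mathbf I}\nabla f(x_1))$, after which it flows again. A solution trajectory is called Zeno-free if the number of jumps within any finite time interval is bounded.
   Formalization: The initial point is assumed to satisfy ∇f(x₁(0)) ≠ 0: at a critical point the feedback law u_I is undefined (zero denominator), the state is a fixed point of the reset map, and the claimed positive lower bound and Zeno-freeness fail. *)

(* Defs.v *)
From mathcomp Require Export all_boot all_order all_algebra.
From mathcomp Require Export all_classical all_reals all_analysis.

Export Order.TTheory GRing.Theory Num.Theory.
Export numFieldNormedType.Exports.

Global Set Implicit Arguments.
Global Unset Strict Implicit.
Global Unset Printing Implicit Defensive.

Global Open Scope classical_set_scope.
Global Open Scope ring_scope.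

(* Vectors of R^n are row vectors.  The library norm on 'rV[R]_n is the
   sup norm, whence the Euclidean structure below; the topology on 'rV[R]_n,
   which the library takes from the sup norm, is the usual one. *)

Definition dotv (R : realType) (n : nat) (u v : 'rV[R]_n) : R :=
  \sum_(i < n) u 0 i * v 0 i.

Definition enorm (R : realType) (n : nat) (v : 'rV[R]_n) : R :=
  Num.sqrt (dotv v v).

Definition opnorm2 (R : realType) (n : nat) (A : 'M[R]_n) : R :=
  sup [set enorm (v *m A) | v in [set v : 'rV[R]_n | enorm v <= 1]].

(* Loewner order: B - A has a nonnegative quadratic form. *)
Definition loewner_le (R : realType) (n : nat) (A B : 'M[R]_n) : Prop :=
  forall v : 'rV[R]_n, 0 <= dotv (v *m (B - A)) v.

Definition grad (R : realType) (n : nat) (f : 'rV[R]_n -> R) (p : 'rV[R]_n) :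
    'rV[R]_n :=
  \row_i 'D_(delta_mx 0 i) f p.

(* Row i is the partial derivative of the gradient in direction i, so that
   v *m hess f p is the Hessian applied to v. *)
Definition hess (R : realType) (n : nat) (f : 'rV[R]_n -> R) (p : 'rV[R]_n) :
    'M[R]_n :=
  \matrix_(i, j) 'D_(delta_mx 0 i) (fun q => grad f q 0 j) p.

Definition twice_differentiable (R : realType) (n : nat)
    (f : 'rV[R]_n -> R) : Prop :=
  (forall p : 'rV[R]_n, differentiable f p) /\
  (forall p : 'rV[R]_n, differentiable (grad f) p).

(* Only meaningful where dotv (grad f x.1) (- x.2) != 0. *)
Definition feedback (R : realType) (n : nat) (f : 'rV[R]_n -> R) (alpha : R)
    (x : 'rV[R]_n * 'rV[R]_n) : R :=
  alpha + (enorm (grad f x.1) ^+ 2 - dotv (x.2 *m hess f x.1) x.2)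
          / dotv (grad f x.1) (- x.2).

Definition flow_set (R : realType) (n : nat) (f : 'rV[R]_n -> R)
    (alpha ulo uhi : R) : set ('rV[R]_n * 'rV[R]_n) :=
  [set x | dotv (grad f x.1) (- x.2) != 0 /\
           ulo <= feedback f alpha x <= uhi].

Definition flow_map (R : realType) (n : nat) (f : 'rV[R]_n -> R) (alpha : R)
    (x : 'rV[R]_n * 'rV[R]_n) : 'rV[R]_n * 'rV[R]_n :=
  (x.2, - grad f x.1 - feedback f alpha x *: x.2).

Definition jump_map (R : realType) (n : nat) (f : 'rV[R]_n -> R) (beta : R)
    (x : 'rV[R]_n * 'rV[R]_n) : 'rV[R]_n * 'rV[R]_n :=
  (x.1, - beta *: grad f x.1).

(* A trajectory on the hybrid time domain
     { (s, j) | t j <= s <= t j.+1 },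
   where t j.+1 is the time of the (j+1)-th jump (+oo if there is none)
   and x j is the continuous arc between jumps j and j+1; x j s is relevant
   only for s in the j-th interval.  The state flows as long as it stays in
   the interior of the flow set, and is reset as soon as it is no longer in
   this interior (in particular at once, if this is so initially). *)
Definition hybrid_solution (R : realType) (n : nat) (f : 'rV[R]_n -> R)
    (alpha beta ulo uhi : R)
    (t : nat -> \bar R) (x : nat -> R -> 'rV[R]_n * 'rV[R]_n) : Prop :=
  [/\ t 0%N = 0%E,
      forall j : nat, (t j <= t j.+1)%E,
      forall j : nat,
        [/\ {within [set s : R | (t j <= s%:E <= t j.+1)%E], continuous (x j)},
            forall s : R, (t j < s%:E < t j.+1)%E ->
              is_derive s (1 : R) (x j) (flow_map f alpha (x j s))
          & forall s : R, (t j <= s%:E < t j.+1)%E ->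
              interior (flow_set f alpha ulo uhi) (x j s)]
    & forall (j : nat) (s : R), t j.+1 = s%:E ->
        ~ interior (flow_set f alpha ulo uhi) (x j s) /\
        x j.+1 s = jump_map f beta (x j s)].

Definition zeno_free (R : realType) (t : nat -> \bar R) : Prop :=
  forall a b : R, exists N : nat,
    ([set j : nat | (a%:E <= t j.+1 <= b%:E)%E] #<= `I_N)%card.

(* Main.v *)
From mathcomp Require Import ring lra.
Require Import Defs.

(** While the state flows, sigma = <grad f x1, - x2> satisfies
    sigma' = - alpha sigma, so sigma is known explicitly after a reset.  The
    bound u <= uhi on the flow set forces |grad f x1| <= C |x2|, whence
    |x2'| <= delta |x2|; therefore |x2|, and with it the displacements of x1,
    x2, grad f x1 and of the Hessian form, grow at most like exp (delta s).
    This bounds the drift of u away from its value at the reset, which lies at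
    distance at least a1 from the ends of [ulo, uhi], and a jump can occur only
    once that distance has been covered.  Since f decreases along the arcs that
    start at a reset, |grad f| is bounded at the jump times by the quadratic
    upper model of f, so the dwell times are bounded below uniformly. *)

(** The number [r] enters only as a cap. With tau the elapsed time and E = exp (delta tau), the
    drift of u over a whole arc is at most (E - 1) (a2 E + a3 E |grad f|), where the functions [a2]
    and [a3] are evaluated at [E] itself. Both are nondecreasing, so E <= r permits replacing their
    argument by [r]. If moreover E - 1 < a1 / (a2 r + a3 r |grad f|), the drift stays below a1.
    Solving E < min (..., r) for tau produces the logarithm and the exponent 1 / delta. A delicate
    point is the terminal time of an arc: the drift has to be estimated exactly there, although the
    state may no longer belong to the flow set. Inequalities that come from the flow set are
    therefore proved inside the arc and carried to its end by continuity. *)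

(** * Euclidean inner product, induced matrix norm and quadratic forms *)

Section Euclidean.
Variables (R : realType) (n : nat).
Implicit Types (u v w : 'rV[R]_n) (A : 'M[R]_n) (k : R).

Lemma dotvC u v : dotv u v = dotv v u.
Proof. by apply: eq_bigr => i _; rewrite mulrC. Qed.

Lemma dotvDl u v w : dotv (u + v) w = dotv u w + dotv v w.
Proof. by rewrite -big_split; apply: eq_bigr => i _; rewrite mxE mulrDl. Qed.

Lemma dotvZl k u v : dotv (k *: u) v = k * dotv u v.
Proof. by rewrite mulr_sumr; apply: eq_bigr => i _; rewrite mxE mulrA. Qed.

Lemma dotvNl u v : dotv (- u) v = - dotv u v.
Proof. by rewrite -scaleN1r dotvZl mulN1r. Qed.

Lemma dotvDr u v w : dotv w (u + v) = dotv w u + dotv w v.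
Proof. by rewrite dotvC dotvDl !(dotvC w). Qed.

Lemma dotvZr k u v : dotv u (k *: v) = k * dotv u v.
Proof. by rewrite dotvC dotvZl dotvC. Qed.

Lemma dotvNr u v : dotv u (- v) = - dotv u v.
Proof. by rewrite dotvC dotvNl dotvC. Qed.

Lemma dot0v v : dotv 0 v = 0.
Proof. by rewrite -(scale0r 0) dotvZl mul0r. Qed.

Definition dotvE := (dotvDl, dotvDr, dotvNl, dotvNr, dotvZl, dotvZr).

Lemma dotvv_ge0 v : 0 <= dotv v v.
Proof. by apply: sumr_ge0 => i _; rewrite -expr2 sqr_ge0. Qed.

Lemma dotvv_eq0 v : (dotv v v == 0) = (v == 0).
Proof.
apply/eqP/eqP => [|->]; last exact: dot0v.
move/eqP; rewrite psumr_eq0 => [/allP v0|i _]; last by rewrite -expr2 sqr_ge0.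
apply/rowP => i; rewrite mxE.
by have /eqP := v0 i (mem_index_enum i); move/eqP; rewrite mulf_eq0 orbb => /eqP.
Qed.

Lemma enorm_ge0 v : 0 <= enorm v.
Proof. exact: sqrtr_ge0. Qed.

Lemma enorm_sqr v : enorm v ^+ 2 = dotv v v.
Proof. by rewrite sqr_sqrtr // dotvv_ge0. Qed.

Lemma enorm_eq0 v : (enorm v == 0) = (v == 0).
Proof. by rewrite -sqrf_eq0 enorm_sqr dotvv_eq0. Qed.

Lemma enorm_gt0 v : (0 < enorm v) = (v != 0).
Proof. by rewrite lt_neqAle enorm_ge0 andbT eq_sym enorm_eq0. Qed.

Lemma enormZ k v : enorm (k *: v) = `|k| * enorm v.
Proof. by rewrite /enorm dotvZl dotvZr mulrA -expr2 sqrtrM ?sqr_ge0// sqrtr_sqr. Qed.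

Lemma enormN v : enorm (- v) = enorm v.
Proof. by rewrite -scaleN1r enormZ normrN1 mul1r. Qed.

Lemma enorm0 : enorm (0 : 'rV[R]_n) = 0.
Proof. by apply/eqP; rewrite enorm_eq0. Qed.

(** Cauchy-Schwarz: expand the square of |v| u - |u| v and divide by |u| |v|. *)
Lemma dotv_le_enorm u v : dotv u v <= enorm u * enorm v.
Proof.
have [->|u0] := eqVneq u 0; first by rewrite dot0v enorm0 mul0r.
have [->|v0] := eqVneq v 0; first by rewrite dotvC dot0v enorm0 mulr0.
have := dotvv_ge0 (enorm v *: u - enorm u *: v).
rewrite !dotvE -!enorm_sqr (dotvC v u).
have Puv : 0 < enorm u * enorm v by rewrite mulr_gt0 ?enorm_gt0.
move=> H; rewrite -(ler_pM2l Puv); nra.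
Qed.

Lemma norm_dotv_le u v : `|dotv u v| <= enorm u * enorm v.
Proof.
by rewrite ler_norml dotv_le_enorm andbT lerNl -dotvNl -(enormN u) dotv_le_enorm.
Qed.

Lemma ler_enormD u v : enorm (u + v) <= enorm u + enorm v.
Proof.
rewrite -(@ler_pXn2r _ 2) ?nnegrE ?addr_ge0 ?enorm_ge0//.
rewrite sqrrD !enorm_sqr !dotvE (dotvC v u).
have := dotv_le_enorm u v; lra.
Qed.

Lemma enorm_delta i : enorm (delta_mx 0 i : 'rV[R]_n) = 1.
Proof.
rewrite /enorm /dotv (bigD1 i)//= big1 ?mxE ?eqxx ?mulr1 ?addr0 ?sqrtr1//.
by move=> j ji; rewrite mxE (negbTE ji) andbF mul0r.
Qed.

Lemma norm_coord_le v i : `|v 0 i| <= enorm v.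
Proof.
have -> : v 0 i = dotv v (delta_mx 0 i).
  rewrite /dotv (bigD1 i)//= big1 ?mxE ?eqxx ?mulr1 ?addr0//.
  by move=> j ji; rewrite mxE (negbTE ji) andbF mulr0.
by rewrite (le_trans (norm_dotv_le _ _))// enorm_delta mulr1.
Qed.

(** [sup] is informative only on a nonempty set bounded above. Cauchy-Schwarz on each column of [A]
    gives the Frobenius norm as an upper bound. *)
Lemma has_sup_opnorm2 A :
  has_sup [set enorm (v *m A) | v in [set v : 'rV[R]_n | enorm v <= 1]].
Proof.
split; first by exists (enorm (0 *m A)), 0 => //=; rewrite enorm0.
exists (Num.sqrt (\sum_j enorm (row j A^T) ^+ 2)) => _ [v /= v1 <-].
apply: ler_wsqrtr; apply: ler_sum => j _.
have -> : (v *m A) 0 j = dotv v (row j A^T).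
  by rewrite mxE; apply: eq_bigr => i _; rewrite !mxE.
have := norm_dotv_le v (row j A^T).
rewrite -expr2 -(real_normK (num_real (dotv _ _))) => H.
rewrite ler_pXn2r ?nnegrE ?enorm_ge0//.
by rewrite (le_trans H)// ler_piMl ?enorm_ge0.
Qed.

Lemma opnorm2_ge0 A : 0 <= opnorm2 A.
Proof.
have := sup_upper_bound (has_sup_opnorm2 A); apply.
by exists 0; rewrite /= ?mul0mx enorm0.
Qed.

Lemma enorm_mulmx_le v A : enorm (v *m A) <= opnorm2 A * enorm v.
Proof.
have [->|v0] := eqVneq v 0; first by rewrite mul0mx enorm0 mulr0.
have nv : 0 < enorm v by rewrite enorm_gt0.
rewrite -ler_pdivrMr//.
have := sup_upper_bound (has_sup_opnorm2 A); apply.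
exists ((enorm v)^-1 *: v) => /=.
  by rewrite enormZ ger0_norm ?invr_ge0 ?enorm_ge0// mulVf ?gt_eqF.
by rewrite -scalemxAl enormZ ger0_norm ?invr_ge0 ?enorm_ge0// mulrC.
Qed.

Lemma norm_coord_opnorm2_le A i j : `|A i j| <= opnorm2 A.
Proof.
have -> : A i j = ((delta_mx 0 i : 'rV_n) *m A) 0 j by rewrite -rowE mxE.
by rewrite (le_trans (norm_coord_le _ _))// (le_trans (enorm_mulmx_le _ _))//
  enorm_delta mulr1.
Qed.

(* No symmetry of A is needed: polarization recovers the symmetric part. *)
Lemma quad_form_polar A k (hA : forall v, `|dotv (v *m A) v| <= k * enorm v ^+ 2) u v :
  `|dotv (u *m A) v + dotv (v *m A) u| <= 2 * k * (enorm u * enorm v).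
Proof.
have [->|u0] := eqVneq u 0.
  by rewrite mul0mx dot0v dotvC dot0v enorm0 addr0 !(mul0r, mulr0) normr0.
have [->|v0] := eqVneq v 0.
  by rewrite mul0mx dot0v dotvC dot0v enorm0 addr0 !(mul0r, mulr0) normr0.
have P : 0 < enorm u * enorm v by rewrite mulr_gt0 ?enorm_gt0.
(* Rescaling both vectors to length |u| |v| makes the two squared norms add up to 4 |u|^2 |v|^2, so
   the bound features the product |u| |v| and not |u|^2 + |v|^2. *)
have := hA (enorm v *: u + enorm u *: v); have := hA (enorm v *: u - enorm u *: v).
rewrite !enorm_sqr !(mulmxDl, mulNmx, =^~ scalemxAl) !dotvE -!enorm_sqr (dotvC v u).
rewrite !ler_norml => /andP[h1 h2] /andP[h3 h4].
by apply/andP; split; rewrite -(ler_pM2l P); lra.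
Qed.

(** The difference of the two forms is half of the symmetrised form at (u - v, u + v), to which
    polarization applies. *)
Lemma quad_form_dist A k (hA : forall v, `|dotv (v *m A) v| <= k * enorm v ^+ 2) u v :
  `|dotv (u *m A) u - dotv (v *m A) v| <= k * (enorm (u - v) * enorm (u + v)).
Proof.
have := quad_form_polar hA (u - v) (u + v).
have -> : dotv ((u - v) *m A) (u + v) + dotv ((u + v) *m A) (u - v)
          = 2 * (dotv (u *m A) u - dotv (v *m A) v).
  by rewrite !(mulmxDl, mulNmx) !dotvE; ring.
by rewrite normrM ger0_norm// -mulrA ler_pM2l.
Qed.

Lemma loewner_le_scalar a b A :
  loewner_le a%:M A -> loewner_le A b%:M ->
  forall v, a * enorm v ^+ 2 <= dotv (v *m A) v <= b * enorm v ^+ 2.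
Proof.
move=> hl hu v; move: (hl v) (hu v).
rewrite !mulmxBr !mul_mx_scalar !dotvE -!enorm_sqr; lra.
Qed.

End Euclidean.

(** * Differentiation along curves, a mean value inequality and a Taylor bound *)

Section Calculus.
Variable R : realType.

Lemma nonincreasing_endpoints (h dh : R -> R) a b : a <= b ->
  {within `[a, b], continuous h} ->
  (forall s, a < s < b -> is_derive s (1 : R) h (dh s)) ->
  (forall s, a < s < b -> dh s <= 0) -> h b <= h a.
Proof.
move=> ab hc hd hle.
apply: (@ler0_derive1_le_cc _ h a b) => //; rewrite ?in_itv/= ?lexx ?ab//.
- by move=> s; rewrite in_itv => /hd [].
- by move=> s; rewrite in_itv derive1E => sab; have [_ ->] := hd _ sab; exact: hle.
Qed.

Lemma is_derive_diff_comp (V W : normedModType R) (h : V -> W) (c : R -> V) s v :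
  differentiable h (c s) -> is_derive s (1 : R) c v ->
  is_derive s (1 : R) (h \o c) ('d h (c s) v).
Proof.
move=> dh [/derivable1_diffP dc cE]; have dhc := differentiable_comp dc dh.
apply: DeriveDef; first exact/derivable1_diffP.
by rewrite deriveE// diff_comp//= -cE [in RHS]deriveE.
Qed.

Lemma is_derive_fst (V W : normedModType R) (c : R -> V * W) s v :
  is_derive s (1 : R) c v -> is_derive s (1 : R) (fst \o c) v.1.
Proof.
have cfst p : differentiable (fst : V * W -> V) p.
  by apply: linear_differentiable => q; exact: cvg_fst.
move=> /(is_derive_diff_comp (cfst _)); rewrite diff_lin// => q; exact: cvg_fst.
Qed.

Lemma is_derive_snd (V W : normedModType R) (c : R -> V * W) s v :
  is_derive s (1 : R) c v -> is_derive s (1 : R) (snd \o c) v.2.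
Proof.
have csnd p : differentiable (snd : V * W -> W) p.
  by apply: linear_differentiable => q; exact: cvg_snd.
move=> /(is_derive_diff_comp (csnd _)); rewrite diff_lin// => q; exact: cvg_snd.
Qed.

Variable n : nat.
Implicit Types (p q v w : 'rV[R]_n) (c : R -> 'rV[R]_n).

Lemma diff_grad (h : 'rV[R]_n -> R) p v : differentiable h p ->
  'd h p v = dotv v (grad h p).
Proof.
move=> dh; rewrite [v in LHS]row_sum_delta linear_sum; apply: eq_bigr => i _.
by rewrite linearZ mxE deriveE.
Qed.

Lemma is_derive_grad (h : 'rV[R]_n -> R) c s v : differentiable h (c s) ->
  is_derive s (1 : R) c v -> is_derive s (1 : R) (h \o c) (dotv v (grad h (c s))).
Proof. by move=> dh dc; rewrite -diff_grad//; exact: is_derive_diff_comp. Qed.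

Lemma is_derive_coord c s v : is_derive s (1 : R) c v ->
  forall i, is_derive s (1 : R) (fun t => c t 0 i) (v 0 i).
Proof.
move=> [dc cE] i; have /derivable_mxP dci := dc.
by apply: DeriveDef; rewrite // -cE derive_mx// mxE.
Qed.

Lemma is_derive_grad_coord (f : 'rV[R]_n -> R) c s v :
  differentiable (grad f) (c s) -> is_derive s (1 : R) c v ->
  forall i, is_derive s (1 : R) (fun t => grad f (c t) 0 i) ((v *m hess f (c s)) 0 i).
Proof.
move=> dg dc i.
have -> : (v *m hess f (c s)) 0 i = dotv v (grad (fun q => grad f q 0 i) (c s)).
  by rewrite mxE; apply: eq_bigr => j _; rewrite !mxE.
apply: (@is_derive_grad (fun q => grad f q 0 i)) => //.
apply: (@differentiable_comp _ _ _ _ (grad f) (fun N : 'rV_n => N 0 i : R)) => //.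
exact: differentiable_coord.
Qed.

Lemma is_derive_dotv c1 c2 s v1 v2 :
  (forall i, is_derive s (1 : R) (fun t => c1 t 0 i) (v1 0 i)) ->
  (forall i, is_derive s (1 : R) (fun t => c2 t 0 i) (v2 0 i)) ->
  is_derive s (1 : R) (fun t => dotv (c1 t) (c2 t)) (dotv v1 (c2 s) + dotv (c1 s) v2).
Proof.
move=> d1 d2.
have := is_derive_sum (fun i => is_deriveM (d1 i) (d2 i)).
have -> : \sum_(i < n) ((fun t => c1 t 0 i) * (fun t => c2 t 0 i)) =
          (fun t => dotv (c1 t) (c2 t)).
  by apply/funext => t; rewrite fct_sumE.
move/is_derive_eq; apply; rewrite -big_split; apply: eq_bigr => i _ /=.
by rewrite addrC [v1 0 i * _]mulrC.
Qed.

Lemma cvg_dotv (T : Type) (F : set_system T) (FF : Filter F) (a b : T -> 'rV[R]_n) p q :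
  a @ F --> p -> b @ F --> q -> dotv (a x) (b x) @[x --> F] --> dotv p q.
Proof.
move=> ap bq; rewrite /dotv; apply: cvg_big => [[x y]|i _].
  by apply: cvgD; [exact: cvg_fst|exact: cvg_snd].
apply: cvgM.
- exact: (cvg_comp _ _ ap (@coord_continuous _ _ _ 0 i p)).
- exact: (cvg_comp _ _ bq (@coord_continuous _ _ _ 0 i q)).
Qed.

Lemma cvg_quad_form (T : Type) (F : set_system T) (FF : Filter F)
    (a : T -> 'rV[R]_n) (A : T -> 'M[R]_n) p (B : 'M[R]_n) :
  a @ F --> p -> (forall i j, A x i j @[x --> F] --> B i j) ->
  dotv (a x *m A x) (a x) @[x --> F] --> dotv (p *m B) p.
Proof.
move=> ap AB.
have ai i : a x 0 i @[x --> F] --> p 0 i.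
  exact: (cvg_comp _ _ ap (@coord_continuous _ _ _ 0 i p)).
rewrite /dotv; apply: cvg_big => [[x y]|j _].
  by apply: cvgD; [exact: cvg_fst|exact: cvg_snd].
apply: cvgM => //; rewrite mxE; under eq_cvg do rewrite mxE.
apply: cvg_big => [[x y]|i _].
  by apply: cvgD; [exact: cvg_fst|exact: cvg_snd].
by apply: cvgM; [exact: ai|exact: AB].
Qed.

Lemma enorm_continuous : continuous (@enorm R n).
Proof.
move=> p; apply: (@continuous_comp _ _ _ (fun q : 'rV[R]_n => dotv q q) Num.sqrt).
  by apply: (@cvg_dotv _ (nbhs p) _ id id p p).
exact: sqrt_continuous.
Qed.

(** Projecting on the increment w = c b - c a reduces to the scalar function <w, c> - |w| K, which
    is nonincreasing by Cauchy-Schwarz; then divide by |w|. For w = 0 the claim is that [K] does not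
    decrease. *)
Lemma vector_mean_value c (dc : R -> 'rV[R]_n) (K dK : R -> R) a b : a <= b ->
  {within `[a, b], continuous c} -> {within `[a, b], continuous K} ->
  (forall s, a < s < b -> forall i, is_derive s (1 : R) (fun t => c t 0 i) (dc s 0 i)) ->
  (forall s, a < s < b -> is_derive s (1 : R) K (dK s)) ->
  (forall s, a < s < b -> enorm (dc s) <= dK s) ->
  enorm (c b - c a) <= K b - K a.
Proof.
move=> ab cc cK dc' dK' le_dK; set w := c b - c a.
pose h s := dotv w (c s) - enorm w * K s.
have : h b <= h a.
  apply: (@nonincreasing_endpoints h (fun s => dotv w (dc s) - enorm w * dK s)) => //.
  - move=> s; apply: cvgB; first by apply: cvg_dotv; [exact: cvg_cst|exact: cc].
    by apply: cvgM; [exact: cvg_cst|exact: cK].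
  - move=> s sab.
    have d0 i : is_derive s (1 : R) (fun t : R => w 0 i) ((0 : 'rV[R]_n) 0 i).
      by rewrite [(0 : 'rV_n) _ _]mxE; exact: is_derive_cst.
    have := is_deriveB (is_derive_dotv d0 (dc' s sab)) (is_deriveZ (enorm w) (dK' s sab)).
    by move/is_derive_eq; apply; rewrite dot0v add0r.
  - move=> s sab; rewrite subr_le0 (le_trans (dotv_le_enorm _ _))//.
    by rewrite ler_wpM2l ?enorm_ge0 ?le_dK.
have [->|w0] := eqVneq w 0.
  move=> _; rewrite enorm0 subr_ge0 -lerN2.
  apply: (@nonincreasing_endpoints (- K) (fun s => - dK s)) => //.
  - by move=> s; apply: cvgN; exact: cK.
  - by move=> s /dK' ?; exact: is_deriveN.
  - by move=> s /le_dK; rewrite oppr_le0; apply: le_trans; exact: enorm_ge0.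
have wE : enorm w ^+ 2 = dotv w (c b) - dotv w (c a).
  by rewrite enorm_sqr {2}/w !dotvE.
move=> hle; rewrite -(@ler_pM2l _ (enorm w)) ?enorm_gt0// -expr2 wE.
by rewrite /h in hle; lra.
Qed.

(** Monotonicity is used twice, for [dphi] minus a linear function and for [phi] minus a quadratic
    one, because [ddphi] may fail to be continuous. *)
Lemma second_order_upper (phi dphi ddphi : R -> R) k :
  (forall s, is_derive s (1 : R) phi (dphi s)) ->
  (forall s, is_derive s (1 : R) dphi (ddphi s)) ->
  (forall s, ddphi s <= k) -> phi 1 <= phi 0 + dphi 0 + k / 2.
Proof.
move=> d1 d2 le_k.
have cont (h dh : R -> R) (A : set R) :
    (forall s, is_derive s (1 : R) h (dh s)) -> {within A, continuous h}.
  move=> dh'; apply: continuous_subspaceT => s.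
  by apply/differentiable_continuous/derivable1_diffP; have [] := dh' s.
have e1 s : 0 <= s -> dphi s <= dphi 0 + k * s.
  move=> s0; suff : dphi s - k * s <= dphi 0 - k * 0 by lra.
  have dd t : is_derive t (1 : R) (fun u => dphi u - k * u) (ddphi t - k).
    have := is_deriveB (d2 t) (is_deriveZ k (is_derive_id t (1 : R))).
    by move/is_derive_eq; apply; rewrite /GRing.scale/= mulr1.
  apply: (@nonincreasing_endpoints _ (fun t => ddphi t - k) 0 s) => //.
  - exact: cont dd.
  - by move=> t _; rewrite subr_le0.
have dd t : is_derive t (1 : R) (fun u => phi u - (dphi 0 * u + k / 2 * u ^+ 2))
    (dphi t - (dphi 0 + k * t)).
  have := is_deriveB (d1 t) (is_deriveD (is_deriveZ (dphi 0) (is_derive_id t (1 : R)))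
    (is_deriveZ (k / 2) (is_deriveX 2 (is_derive_id t (1 : R))))).
  by move/is_derive_eq; apply; rewrite /GRing.scale/=; field.
have : phi 1 - (dphi 0 * 1 + k / 2 * 1 ^+ 2) <= phi 0 - (dphi 0 * 0 + k / 2 * 0 ^+ 2).
  apply: (@nonincreasing_endpoints _ (fun t => dphi t - (dphi 0 + k * t)) 0 1) => //.
  - exact: cont dd.
  - by move=> t /andP[/ltW t0 _]; rewrite subr_le0 e1.
lra.
Qed.

End Calculus.

(** * Consequences of the curvature bounds, and continuity of the feedback *)

Section Objective.
Variables (R : realType) (n : nat) (f : 'rV[R]_n -> R) (lf Lf : R).
Hypothesis hsmooth : twice_differentiable f.
Hypothesis hhess : forall p : 'rV[R]_n,
  loewner_le (- lf)%:M (hess f p) /\ loewner_le (hess f p) Lf%:M.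
Implicit Types p q v w : 'rV[R]_n.

Lemma hess_quad_bounds p v :
  - lf * enorm v ^+ 2 <= dotv (v *m hess f p) v <= Lf * enorm v ^+ 2.
Proof. by have [hl hu] := hhess p; exact: loewner_le_scalar hl hu v. Qed.

Lemma norm_hess_quad_le p v :
  `|dotv (v *m hess f p) v| <= Num.max lf Lf * enorm v ^+ 2.
Proof.
have /andP[h1 h2] := hess_quad_bounds p v; have s0 := sqr_ge0 (enorm v).
rewrite ler_norml lerNl; apply/andP; split.
  by rewrite (@le_trans _ _ (lf * enorm v ^+ 2))//; [lra|rewrite ler_wpM2r ?le_max ?lexx].
by rewrite (le_trans h2)// ler_wpM2r ?le_max ?lexx ?orbT.
Qed.

(** Restrict f to the line s -> p + s v; the lower model is the upper one for -f. *)
Lemma taylor_bounds p v :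
  f p + dotv v (grad f p) - lf / 2 * enorm v ^+ 2 <= f (p + v)
  <= f p + dotv v (grad f p) + Lf / 2 * enorm v ^+ 2.
Proof.
have [df dg] := hsmooth.
pose c (s : R) := p + s *: v.
have dc s : is_derive s (1 : R) c v.
  apply: (@is_derive_eq _ _ _ _ _ _ _ (0 + v)); last by rewrite add0r.
  apply: is_deriveD; apply: DeriveDef; first exact/derivable1_diffP.
  by rewrite deriveE// diff_val scale1r.
have d1 s : is_derive s (1 : R) (f \o c) (dotv v (grad f (c s))).
  exact: is_derive_grad.
have d2 s : is_derive s (1 : R) (fun t => dotv v (grad f (c t)))
    (dotv (v *m hess f (c s)) v).
  have d0 i : is_derive s (1 : R) (fun t : R => v 0 i) ((0 : 'rV[R]_n) 0 i).
    by rewrite [(0 : 'rV_n) _ _]mxE; exact: is_derive_cst.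
  have := is_derive_dotv d0 (is_derive_grad_coord (dg (c s)) (dc s)).
  by move/is_derive_eq; apply; rewrite dot0v add0r dotvC.
have c0 : c 0 = p by rewrite /c scale0r addr0.
have c1 : c 1 = p + v by rewrite /c scale1r.
apply/andP; split.
  have := @second_order_upper R (- (f \o c)) _ _ (lf * enorm v ^+ 2)
    (fun s => is_deriveN (d1 s)) (fun s => is_deriveN (d2 s)).
  have H s : - dotv (v *m hess f (c s)) v <= lf * enorm v ^+ 2.
    by have /andP[] := hess_quad_bounds (c s) v; lra.
  by move/(_ H); rewrite !fctE /= c0 c1; lra.
have H s : dotv (v *m hess f (c s)) v <= Lf * enorm v ^+ 2.
  by have /andP[] := hess_quad_bounds (c s) v.
by have := second_order_upper d1 d2 H; rewrite /= c0 c1; lra.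
Qed.

(* Comparing the two quadratic models at the points (p + q) / 2 +/- w bounds
   <grad f q - grad f p, w>; this avoids the symmetry of the Hessian. *)
Lemma grad_lipschitz p q : 0 <= lf ->
  enorm (grad f q - grad f p) <= Num.max lf Lf * enorm (q - p).
Proof.
move=> lf0; set M := Num.max lf Lf.
have [d dE] : {d | d = 2^-1 *: (q - p)} by eexists.
set G := grad f q - grad f p.
have M0 : 0 <= M by rewrite le_max lf0.
have T x v : f x + dotv v (grad f x) - M / 2 * dotv v v <= f (x + v)
    <= f x + dotv v (grad f x) + M / 2 * dotv v v.
  have /andP[h1 h2] := taylor_bounds x v; rewrite enorm_sqr in h1 h2.
  have m1 : lf <= M by rewrite le_max lexx.
  have m2 : Lf <= M by rewrite le_max lexx orbT.
  have := dotvv_ge0 v; nra.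
have key w : dotv G w <= M * (dotv w w + dotv d d).
  have e1 : p + (d + w) = q + (w - d).
    by apply/rowP => i; rewrite dE !mxE; field.
  have e2 : p + (d - w) = q + (- w - d).
    by apply/rowP => i; rewrite dE !mxE; field.
  have /andP[_] := T p (d + w); have /andP[+ _] := T q (w - d).
  have /andP[+ _] := T p (d - w); have /andP[_] := T q (- w - d).
  rewrite -e1 -e2 /G !dotvE (dotvC (grad f q) w) (dotvC (grad f p) w) (dotvC w d).
  lra.
have d4 : 4 * dotv d d = enorm (q - p) ^+ 2 by rewrite enorm_sqr dE !dotvE; field.
have [M_eq0|Mneq0] := eqVneq M 0.
  have := key G; rewrite M_eq0 !mul0r -enorm_sqr => G0.
  by rewrite -(@ler_pXn2r _ 2) ?nnegrE ?enorm_ge0// expr0n.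
have Mp : 0 < M by rewrite lt_neqAle eq_sym Mneq0.
(* This [w] maximises <G, w> - M |w|^2. *)
have := key ((2 * M)^-1 *: G); rewrite dotvZl !dotvZr -(enorm_sqr G).
set g := enorm G => H.
rewrite -(@ler_pXn2r _ 2) ?nnegrE ?mulr_ge0 ?enorm_ge0// exprMn -d4 -/g.
have -> : g ^+ 2 = (4 * M) * ((2 * M)^-1 * g ^+ 2 - M * ((2 * M)^-1 * ((2 * M)^-1 * g ^+ 2))).
  by field.
rewrite [leRHS](_ : _ = (4 * M) * (M * dotv d d)); last by ring.
by rewrite ler_pM2l ?mulr_gt0//; lra.
Qed.

(** Compare [fstar] with the upper model after a gradient step of length 1 / (Lf + 1); the shift by
    1 guards against Lf = 0. This turns a bound on f at the jump times into a bound on its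
    gradient. *)
Lemma grad_sqr_le p fstar : 0 <= Lf -> (forall q, fstar <= f q) ->
  enorm (grad f p) ^+ 2 <= 2 * (Lf + 1) * (f p - fstar).
Proof.
move=> Lf0 hstar; set k := (Lf + 1)^-1.
have k0 : 0 < k by rewrite invr_gt0; lra.
have kE : (Lf + 1) * k = 1 by rewrite divff// gt_eqF//; lra.
have /andP[_] := taylor_bounds p (- k *: grad f p).
have := hstar (p + - k *: grad f p).
rewrite enorm_sqr !dotvE -!enorm_sqr; set N := enorm _ ^+ 2 => h1 h2.
have N0 : 0 <= N by exact: sqr_ge0.
have H : k * N / 2 <= f p - fstar.
  suff : Lf / 2 * (- k * (- k * N)) <= k * N / 2 by lra.
  have -> : Lf / 2 * (- k * (- k * N)) = (Lf + 1) * k * (k * N) / 2 - k * k * N / 2 by ring.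
  rewrite kE; have : 0 <= k * k * N by rewrite mulr_ge0// mulr_ge0// ltW.
  lra.
have kN : (Lf + 1) * k * N = N by rewrite kE mul1r.
have -> : N = 2 * (Lf + 1) * (k * N / 2) by lra.
by rewrite ler_pM2l//; lra.
Qed.

Lemma grad_continuous : continuous (grad f).
Proof. by move=> p; apply: differentiable_continuous; exact: hsmooth.2. Qed.

Variable Hf : R.
Hypothesis hhessLip : forall p q,
  opnorm2 (hess f p - hess f q) <= Hf * enorm (p - q).

Lemma hess_coord_continuous i j : continuous (fun p => hess f p i j).
Proof.
move=> p; apply/(@cvgrPdist_le _ _ _ (nbhs p) (nbhs_filter p)) => e e0.
have : Hf * enorm (p - q) @[q --> p] --> Hf * enorm (p - p).
  apply: (@cvgM _ _ (nbhs p) _ (fun=> Hf) (fun q => enorm (p - q))); first exact: cvg_cst.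
  apply: (@continuous_comp _ _ _ (fun q => p - q)); last exact: enorm_continuous.
  by apply: (@cvgB _ _ _ (nbhs p) _ (fun=> p) id); [exact: cvg_cst|exact: cvg_id].
rewrite subrr enorm0 mulr0 => /cvgr_le/(_ _ e0); apply: filterS => q.
apply: le_trans; rewrite (le_trans _ (hhessLip p q))//.
have := norm_coord_opnorm2_le (hess f p - hess f q) i j.
suff mB (A B : 'M[R]_n) : (A - B) i j = A i j - B i j by rewrite mB.
by rewrite !mxE.
Qed.

Lemma feedback_continuous alpha (x : 'rV[R]_n * 'rV[R]_n) :
  dotv (grad f x.1) (- x.2) != 0 -> {for x, continuous (feedback f alpha)}.
Proof.
move=> sx0.
have c1 : y.1 @[y --> x] --> x.1 by exact: cvg_fst.
have c2 : y.2 @[y --> x] --> x.2 by exact: cvg_snd.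
have cg : grad f y.1 @[y --> x] --> grad f x.1.
  by apply: (@continuous_comp _ _ _ fst (grad f)) => //; exact: grad_continuous.
apply: cvgD; first exact: cvg_cst.
apply: cvgM; last by apply: cvgV => //; apply: cvg_dotv => //; exact: cvgN.
apply: cvgB.
  by rewrite enorm_sqr; under eq_cvg do rewrite enorm_sqr; exact: cvg_dotv.
apply: cvg_quad_form => // i j.
by apply: (@continuous_comp _ _ _ fst (fun p => hess f p i j)) => //;
  exact: hess_coord_continuous.
Qed.

(** Strict inequalities persist near [x] by continuity of sigma and u. Read contrapositively: a
    state with nonzero sigma that triggers a jump has u outside the open interval from [ulo] to
    [uhi]. *)
Lemma interior_flow_set alpha ulo uhi (x : 'rV[R]_n * 'rV[R]_n) :
  dotv (grad f x.1) (- x.2) != 0 -> ulo < feedback f alpha x < uhi ->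
  interior (flow_set f alpha ulo uhi) x.
Proof.
move=> sx0 /andP[ulox uxhi].
have cf : {for x, continuous (feedback f alpha)} by exact: feedback_continuous.
have cs : dotv (grad f y.1) (- y.2) @[y --> x] --> dotv (grad f x.1) (- x.2).
  apply: cvg_dotv; last by apply: cvgN; exact: cvg_snd.
  by apply: (@continuous_comp _ _ _ fst (grad f)); [exact: cvg_fst|exact: grad_continuous].
have n1 := @cvgr_neq0 _ _ _ _ (nbhs_filter x) _ _ cs sx0.
have n2 := @cvgr_gt _ _ _ (nbhs_filter x) _ _ cf _ ulox.
have n3 := @cvgr_lt _ _ _ (nbhs_filter x) _ _ cf _ uxhi.
rewrite /interior; apply: filterS (filterI n1 (filterI n2 n3)).
by move=> y [/= s1 [/ltW s2 /ltW s3]]; split=> //; rewrite s2.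
Qed.

End Objective.

(** * Scalar inequalities behind the drift bound *)

Section Estimate.
Variable R : realType.
Implicit Types alpha beta delta lf Lf C b E : R.

(* The coefficient of the first term is only Lf, although the Lipschitz
   constant of the gradient is max lf Lf.  When lf > Lf the missing part is
   recovered from the slack in the other terms: there delta exceeds
   alpha + 2 / beta + 2 lf beta, and b <= 1 + alpha / delta * (E - 1). *)
Lemma feedback_drift_coefficient alpha beta delta lf Lf C b E gain :
  let M := Num.max lf Lf in
  0 < alpha -> 0 < beta -> 0 < delta -> 0 <= lf -> 0 <= Lf -> 0 <= C ->
  1 <= b <= E -> delta * (b - 1) <= alpha * (E - 1) ->
  2 + alpha * beta + 2 * lf * beta ^+ 2 <= beta * delta ->
  0 <= gain -> gain <= beta * C * E -> gain <= 1 + M * beta * delta^-1 * (E - 1) ->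
  b * (M * beta * delta^-1 * (E - 1) * (gain + 1)) + (b - 1)
    + (b - 1) * (M * beta ^+ 2) + b * (M * beta ^+ 2 * ((E - 1) * (E + 1)))
  <= beta * (E - 1) * (E * Lf * delta^-1 * (E * beta * C + 1) + beta^-1
                       + (E ^+ 2 + E + 1) * beta * M).
Proof.
move=> M a0 be0 d0 lf0 Lf0 C0 /andP[b1 bE] bth hd g0 gA gB.
(* In the application, b = exp (alpha tau), E = exp (delta tau), and [gain] is the ratio of |grad f|
   at the end of the arc to its value at the reset. *)
have [e0 e1] : 0 <= E - 1 /\ 1 <= E by split; lra.
have u0 : 0 < delta^-1 by rewrite invr_gt0.
have du : delta * delta^-1 = 1 by rewrite divff ?gt_eqF.
have bb : beta * beta^-1 = 1 by rewrite divff ?gt_eqF.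
set u := delta^-1 in u0 du gB *; set e := E - 1 in e0 bth gB *.
have [a0' be0' u0'] : [/\ 0 <= alpha, 0 <= beta & 0 <= u] by split; exact: ltW.
have EE : E = 1 + e by rewrite /e; ring.
have M0 : 0 <= M by rewrite le_max lf0.
have be_e : 0 <= beta * e by rewrite mulr_ge0.
rewrite [leRHS](_ : _ = beta * e * (E * Lf * u * (E * beta * C + 1)) + (beta * beta^-1) * e
  + (E ^+ 2 + E + 1) * (M * beta ^+ 2 * e)); last by ring.
rewrite bb mul1r.
have k0 : 0 <= M * beta ^+ 2 * e by rewrite !mulr_ge0// exprn_ge0.
have kb0 : 0 <= M * beta ^+ 2 by rewrite !mulr_ge0// exprn_ge0.
(* If M = Lf, the terms compare one by one, through gain <= beta C E and b <= E. *)
have [lL|Ll] := leP lf Lf.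
  have ME : M = Lf by rewrite /M max_r.
  rewrite -ME.
  have h0 : 0 <= M * beta * u * e by rewrite !mulr_ge0.
  have h1 : b * (M * beta * u * e * (gain + 1)) <= E * (M * beta * u * e * (beta * C * E + 1)).
    apply: ler_pM => //; first lra.
      by rewrite mulr_ge0// addr_ge0.
    by rewrite ler_wpM2l//; lra.
  have h2 : (b - 1) * (M * beta ^+ 2) <= e * (M * beta ^+ 2) by rewrite ler_wpM2r// /e; lra.
  have h3 : b * (M * beta ^+ 2 * (e * (E + 1))) <= E * (M * beta ^+ 2 * (e * (E + 1))).
    by rewrite ler_wpM2r// !mulr_ge0 ?exprn_ge0//; lra.
  have h4 : b - 1 <= e by rewrite /e; lra.
  lra.
(* If M = lf > Lf, the [Lf] term is discarded. With th = alpha / delta, the lower bound on beta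
   delta gives 2 / delta <= beta (1 - th) and M beta / delta <= 1 / 2, which absorb the variation of
   the gradient. *)
have ME : M = lf by rewrite /M max_l ?ltW.
set th := alpha * u.
have th0 : 0 <= th by rewrite mulr_ge0.
have bub : b - 1 <= th * e.
  rewrite -(ler_pM2l d0) (le_trans bth)// /th.
  by rewrite (_ : delta * _ = delta * u * (alpha * e)); [rewrite du mul1r|ring].
have hu : 2 * u + th * beta + 2 * M * beta * (beta * u) <= beta.
  rewrite -(ler_pM2l d0) /th.
  rewrite [leLHS](_ : _ = delta * u * (2 + alpha * beta + 2 * M * beta ^+ 2)); last by ring.
  by rewrite du mul1r ME (mulrC delta).
have Mbu : 0 <= M * beta * u by rewrite !mulr_ge0.
have thb : 2 * u <= beta * (1 - th).
  have : 0 <= 2 * M * beta * (beta * u) by rewrite !mulr_ge0.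
  lra.
have th1 : 0 <= 1 - th by rewrite -(pmulr_rge0 _ be0); lra.
have Mbu2 : 2 * (M * beta * u) <= 1.
  rewrite -(ler_pM2l be0); have : 0 <= th * beta by rewrite mulr_ge0.
  lra.
have s1 : M * beta * u * e * (gain + 1) <= M * beta ^+ 2 * e * ((1 - th) / 2 * (2 + e / 2)).
  have -> : M * beta * u * e * (gain + 1) = M * beta * e * (u * (gain + 1)) by ring.
  have -> : M * beta ^+ 2 * e * ((1 - th) / 2 * (2 + e / 2))
    = M * beta * e * (beta * (1 - th) / 2 * (2 + e / 2)) by ring.
  have m0 : 0 <= M * beta * e by rewrite !mulr_ge0.
  rewrite ler_wpM2l//; apply: ler_pM; [exact: ltW|lra|lra|].
  have : M * beta * u * e <= 1 / 2 * e by rewrite ler_wpM2r//; lra.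
  lra.
have b_ub : b <= 1 + th * e by lra.
have h1 : b * (M * beta * u * e * (gain + 1))
    <= (1 + th * e) * (M * beta ^+ 2 * e * ((1 - th) / 2 * (2 + e / 2))).
  by apply: ler_pM => //; [lra|rewrite !mulr_ge0 //; lra].
have h2 : (b - 1) * (M * beta ^+ 2) <= th * (M * beta ^+ 2 * e).
  have := ler_wpM2r kb0 bub; lra.
have h3 : b * (M * beta ^+ 2 * (e * (E + 1))) <= (1 + th * e) * (2 + e) * (M * beta ^+ 2 * e).
  have -> : b * (M * beta ^+ 2 * (e * (E + 1))) = b * (2 + e) * (M * beta ^+ 2 * e).
    by rewrite EE; ring.
  by rewrite ler_wpM2r// ler_wpM2r//; lra.
have h4 : b - 1 <= e by rewrite /e; lra.
have h5 : 0 <= beta * e * (E * Lf * u * (E * beta * C + 1)).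
  have E0 : 0 <= E by lra.
  by rewrite mulr_ge0// !mulr_ge0// addr_ge0// !mulr_ge0.
(* The bounds [h1], [h2], [h3] share the factor M beta^2 e. The remaining inequality is polynomial
   in [th] and [e], and the difference of its sides has the factor 1 - th >= 0. *)
have h6 : (1 + th * e) * ((1 - th) / 2 * (2 + e / 2)) + th + (1 + th * e) * (2 + e)
    <= E ^+ 2 + E + 1.
  rewrite -subr_ge0 EE.
  rewrite [leRHS](_ : _ = (1 - th) * (e * (2 + e) - th * e - (1 + th * e) * e / 4));
    last by field.
  have t1 : th * e <= e by rewrite ler_piMl//; lra.
  have t2 : th * e * e <= e * e by rewrite ler_wpM2r.
  have t3 : 0 <= e * e by rewrite mulr_ge0.
  by rewrite mulr_ge0//; lra.
have := ler_wpM2r k0 h6; lra.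
Qed.

(** [s / e] is sigma after its decay from [s]. [Qm] evaluates the Hessian at the reset point on the
    final velocity, so that [Qb - Qm] sees only the change of Hessian and [Qm - Qa] only the change
    of velocity. *)
Lemma feedback_drift_split alpha s e Gb Ga Qb Qm Qa : s != 0 -> e != 0 ->
  alpha + (Gb - Qb) / (s / e) - (alpha + (Ga - Qa) / s)
  = (e * (Gb - Ga) + (e - 1) * Ga - e * (Qb - Qm) - e * (Qm - Qa) - (e - 1) * Qa) / s.
Proof. by move=> s0 e0; field; rewrite s0. Qed.

(** The change of Hessian, bounded by [B1], is charged the factor [E] instead of [b]: together with
    the squared speed it makes the cube in [a3]. The other terms are gathered in [K], the share of
    [a2]. *)
Lemma ler_norm_drift b E g P q1 q2 q3 B0 B1 B2 B3 K :
  1 <= b -> b <= E -> 0 <= P -> `|g| <= B0 -> `|q1| <= B1 -> `|q2| <= B2 -> `|q3| <= B3 ->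
  b * B0 + (b - 1) * P + (b - 1) * B3 + b * B2 <= K ->
  `|b * g + (b - 1) * P - b * q1 - b * q2 - (b - 1) * q3| <= K + E * B1.
Proof.
move=> b1 bE P0 hg h1 h2 h3 hK.
have b0 : 0 <= b by lra.
have c0 : 0 <= b - 1 by lra.
have cP : 0 <= (b - 1) * P by rewrite mulr_ge0.
have B10 : 0 <= B1 by exact: le_trans (normr_ge0 _) h1.
have hE := ler_wpM2r B10 bE.
have bound (c q B : R) : 0 <= c -> `|q| <= B -> - (c * B) <= c * q <= c * B.
  by move=> c0' hq; rewrite -ler_norml normrM ger0_norm// ler_wpM2l.
have := bound _ _ _ c0 h3; have := bound _ _ _ b0 h2.
have := bound _ _ _ b0 h1; have := bound _ _ _ b0 hg.
move=> /andP[? ?] /andP[? ?] /andP[? ?] /andP[? ?].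
by rewrite ler_norml; apply/andP; split; lra.
Qed.

End Estimate.

(** * Flow arcs and the evolution of sigma *)

Section FlowArc.
Variables (R : realType) (n : nat) (f : 'rV[R]_n -> R) (alpha ulo uhi : R).
Hypothesis hsmooth : twice_differentiable f.
Implicit Types (a b s k : R) (X : R -> 'rV[R]_n * 'rV[R]_n) (y : 'rV[R]_n * 'rV[R]_n).

(** Only continuity is asked at the endpoints, because at a jump the state has left the interior of
    the flow set. *)
Definition flow_arc a b X :=
  [/\ {within `[a, b], continuous X},
      forall s, a < s < b -> is_derive s (1 : R) X (flow_map f alpha (X s))
    & forall s, a < s < b -> flow_set f alpha ulo uhi (X s)].

(** This is sigma, the denominator of [feedback]; along the flow f decreases at exactly this
    rate. *)
Definition dissipation y := dotv (grad f y.1) (- y.2).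

Lemma flow_arc_sub a b c d X : a <= c -> d <= b -> flow_arc a b X -> flow_arc c d X.
Proof.
move=> ac db [cX dX sX].
have sub s : c < s < d -> a < s < b.
  by move=> /andP[cs sd]; rewrite (le_lt_trans ac)//= (lt_le_trans sd).
split; [|by move=> s /sub; exact: dX|by move=> s /sub; exact: sX].
by apply: continuous_subspaceW cX => s /=; rewrite !in_itv/= => /andP[cs sd];
  rewrite (le_trans ac)//= (le_trans sd).
Qed.

Lemma within_continuous_comp (T U : topologicalType) (A : set R) (h : T -> U) (c : R -> T) :
  continuous h -> {within A, continuous c} -> {within A, continuous (h \o c)}.
Proof.
by move=> ch cc s; apply: (@continuous_comp (subspace A) T U c h s);
  [exact: cc|exact: ch].
Qed.

Lemma grad_fst_continuous : continuous (fun y => grad f y.1).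
Proof.
by move=> y; apply: (@continuous_comp _ _ _ fst (grad f));
  [exact: cvg_fst|exact: grad_continuous].
Qed.

Lemma dissipation_continuous : continuous dissipation.
Proof.
move=> y; apply: cvg_dotv; first exact: grad_fst_continuous.
by apply: cvgN; exact: cvg_snd.
Qed.

Lemma is_derive_expR_affine k a s :
  is_derive s (1 : R) (fun t => expR (k * (t - a))) (k * expR (k * (s - a))).
Proof.
have dl : is_derive s (1 : R) (fun t => k * (t - a)) k.
  have := is_deriveZ k (is_deriveB (is_derive_id s (1 : R)) (is_derive_cst a s 1)).
  by move/is_derive_eq; apply; rewrite /GRing.scale/= subr0 mulr1.
by rewrite mulrC; exact: is_derive1_comp (is_derive_expR _) dl.
Qed.

Lemma expR_affine_continuous k a (A : set R) :
  {within A, continuous (fun t => expR (k * (t - a)))}.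
Proof.
apply: continuous_subspaceT => s; apply/differentiable_continuous/derivable1_diffP.
by have [] := is_derive_expR_affine k a s.
Qed.

Section Derivatives.
Variables (a b : R) (X : R -> 'rV[R]_n * 'rV[R]_n).
Hypothesis hX : flow_arc a b X.

Lemma flow_arc_derive1 s : a < s < b -> is_derive s (1 : R) (fst \o X) (X s).2.
Proof. by case: hX => _ dX _ /dX /is_derive_fst. Qed.

Lemma flow_arc_derive2 s : a < s < b ->
  is_derive s (1 : R) (snd \o X) (- grad f (X s).1 - feedback f alpha (X s) *: (X s).2).
Proof. by case: hX => _ dX _ /dX /is_derive_snd. Qed.

(** Differentiation gives sigma' = |grad f|^2 - <hess f x2, x2> - u sigma, and u is designed so that
    u sigma cancels the first two terms up to alpha sigma. *)
Lemma flow_arc_derive_dissipation s : a < s < b ->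
  is_derive s (1 : R) (dissipation \o X) (- alpha * dissipation (X s)).
Proof.
move=> sab; case: hX => _ _ /(_ _ sab) [ds0 _].
have d1 := is_derive_grad_coord (hsmooth.2 _) (flow_arc_derive1 sab).
have d2 i := is_deriveN (is_derive_coord (flow_arc_derive2 sab) i).
have d2' i : is_derive s (1 : R) (fun t => (- (X t).2) 0 i)
    ((grad f (X s).1 + feedback f alpha (X s) *: (X s).2) 0 i).
  apply: (@is_derive_eq _ _ _ _ _ _ _
    (- (- grad f (X s).1 - feedback f alpha (X s) *: (X s).2) 0 i)).
    have -> : (fun t => (- (X t).2) 0 i) = - (fun t => (X t).2 0 i).
      by apply/funext => t; rewrite mxE.
    exact: d2.
  by rewrite !mxE; ring.
have := is_derive_dotv d1 d2'; move/is_derive_eq; apply.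
rewrite /feedback /dissipation enorm_sqr.
set q := X s in ds0 *; rewrite !dotvE in ds0 *.
set H := dotv (q.2 *m _) _; set g := dotv (grad f q.1) q.2 in ds0 *.
by field; rewrite -[g]opprK oppr_eq0.
Qed.

Hypothesis ab : a <= b.

Lemma flow_arc_dissipation :
  dissipation (X b) = dissipation (X a) * expR (- alpha * (b - a)).
Proof.
case: (hX) => cX _ _.
pose h s := dissipation (X s) * expR (alpha * (s - a)).
have ch : {within `[a, b], continuous h}.
  move=> s; apply: cvgM; last exact: expR_affine_continuous.
  exact: (within_continuous_comp dissipation_continuous cX).
have dh s : a < s < b -> is_derive s (1 : R) h 0.
  move=> sab.
  have := is_deriveM (flow_arc_derive_dissipation sab) (is_derive_expR_affine alpha a s).
  by move/is_derive_eq; apply; rewrite /GRing.scale/=; ring.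
have h1 : h b <= h a by apply: nonincreasing_endpoints dh _.
have h2 : - h b <= - h a.
  apply: (@nonincreasing_endpoints _ (- h) (fun=> - 0)) => //.
  - by move=> s; apply: cvgN; exact: ch.
  - by move=> s /dh ?; exact: is_deriveN.
have : h b = h a by apply/eqP; rewrite eq_le h1 -lerN2 h2.
rewrite /h subrr mulr0 expR0 mulr1 => <-.
by rewrite -mulrA -expRD mulNr subrr expR0 mulr1.
Qed.

End Derivatives.

Lemma flow_arc_dissipation_at a b X s : flow_arc a b X -> a <= s <= b ->
  dissipation (X s) = dissipation (X a) * expR (- alpha * (s - a)).
Proof.
by move=> hX /andP[as' sb]; apply: flow_arc_dissipation as'; exact: flow_arc_sub sb hX.
Qed.

Lemma flow_arc_objective_le a b X : flow_arc a b X -> a <= b ->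
  0 < dissipation (X a) -> f (X b).1 <= f (X a).1.
Proof.
move=> hX ab s0; case: (hX) => cX _ _.
apply: (@nonincreasing_endpoints _ (f \o (fst \o X)) (fun s => - dissipation (X s))) => //.
- apply: within_continuous_comp; last first.
    by apply: within_continuous_comp => // y; exact: cvg_fst.
  by move=> p; apply: differentiable_continuous; exact: hsmooth.1.
- move=> s sab; have := is_derive_grad (hsmooth.1 _) (flow_arc_derive1 hX sab).
  by move/is_derive_eq; apply; rewrite /dissipation !dotvE opprK dotvC.
- move=> s /andP[as' sb]; rewrite oppr_le0 (@flow_arc_dissipation_at _ _ _ _ hX);
    last by rewrite !ltW.
  by rewrite mulr_ge0 ?expR_ge0// ltW.
Qed.

End FlowArc.

(** Carries a closed inequality from the inside of an arc to its terminal time. *)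
Lemma left_limit_ge0 (R : realType) (h : R -> R) a b : a < b ->
  {within `[a, b], continuous h} -> (forall s, a < s < b -> 0 <= h s) -> 0 <= h b.
Proof.
move=> ab /(continuous_within_itvP _ ab)[_ _ hb] h0; rewrite leNgt; apply/negP => hb0.
have n1 : \forall s \near b^'-, h s < 0 by exact: (@cvgr_lt _ _ _ _ _ _ hb).
have n2 : \forall s \near b^'-, a < s by exact: nbhs_left_gt.
have n3 : \forall s \near b^'-, s < b by exact: nbhs_left_lt.
have [s [hs [as' sb]]] : exists s, h s < 0 /\ a < s /\ s < b.
  exact: (@filter_ex _ b^'- (at_left_proper_filter b) _
    (@filterI _ _ _ _ _ n1 (@filterI _ _ _ _ _ n2 n3))).
by have := h0 s; rewrite as' sb leNgt hs => /(_ isT).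
Qed.

(** In other words, (exp (k t) - 1) / k is nondecreasing in k; it compares the decay rate alpha with
    delta. *)
Lemma expR_sub1_mono (R : realType) (k1 k2 t : R) : 0 <= k1 <= k2 -> 0 <= t ->
  k2 * (expR (k1 * t) - 1) <= k1 * (expR (k2 * t) - 1).
Proof.
move=> /andP[k10 k12] t0.
pose h s : R := k2 * expR (k1 * (s - 0)) - k1 * expR (k2 * (s - 0)).
have dh s : is_derive s (1 : R) h
    (k2 * (k1 * expR (k1 * (s - 0))) - k1 * (k2 * expR (k2 * (s - 0)))).
  exact: is_deriveB (is_deriveZ k2 (is_derive_expR_affine k1 0 s))
                    (is_deriveZ k1 (is_derive_expR_affine k2 0 s)).
suff : h t <= h 0 by rewrite /h !subr0 !mulr0 !expR0; lra.
apply: (nonincreasing_endpoints t0 _ (fun s _ => dh s)).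
  apply: continuous_subspaceT => s.
  by apply/differentiable_continuous/derivable1_diffP; case: (dh s).
move=> s /andP[/ltW s0 _]; rewrite subr_le0 mulrCA; apply: ler_wpM2l => //.
by apply: ler_wpM2l; rewrite ?(le_trans k10)// ler_expR subr0 ler_wpM2r.
Qed.

(** * Exponential growth of speed and displacements along an arc *)

Section Growth.
Variables (R : realType) (n : nat) (f : 'rV[R]_n -> R).
Variables (alpha ulo uhi lf Lf C : R).
Hypothesis hsmooth : twice_differentiable f.
Hypothesis hhess : forall p : 'rV[R]_n,
  loewner_le (- lf)%:M (hess f p) /\ loewner_le (hess f p) Lf%:M.
Hypothesis C_ge0 : 0 <= C.
Hypothesis C_ge : uhi - alpha <= C.
Hypothesis C_root : C ^+ 2 = (uhi - alpha) * C + Lf.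
Hypothesis uhi_ge : alpha <= uhi.
Implicit Types (a b s : R) (X : R -> 'rV[R]_n * 'rV[R]_n) (y : 'rV[R]_n * 'rV[R]_n).

Let delta := C + Num.max uhi (- ulo).
Hypothesis delta_gt0 : 0 < delta.

(** For sigma > 0, u <= uhi and sigma <= |grad f| |x2| give g^2 <= (uhi - alpha) g v + Lf v^2 with g
    = |grad f| and v = |x2|. [C] is the nonnegative root of z^2 = (uhi - alpha) z + Lf, so the
    quadratic is positive for g > C v. *)
Lemma enorm_grad_le_velocity y : 0 < dissipation f y -> flow_set f alpha ulo uhi y ->
  enorm (grad f y.1) <= C * enorm y.2.
Proof.
move=> s0 [_ /andP[_]]; rewrite /feedback -/(dissipation f y) => hu.
have {}hu : enorm (grad f y.1) ^+ 2 - dotv (y.2 *m hess f y.1) y.2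
    <= (uhi - alpha) * dissipation f y.
  by rewrite -ler_pdivrMr//; lra.
have /andP[_ hq] := hess_quad_bounds hhess y.1 y.2.
have hs : dissipation f y <= enorm (grad f y.1) * enorm y.2.
  by rewrite (le_trans (dotv_le_enorm _ _))// enormN.
have k0 : 0 <= uhi - alpha by rewrite subr_ge0.
have hs' := ler_wpM2l k0 hs.
have g0 := enorm_ge0 (grad f y.1); have v0 := enorm_ge0 y.2.
set g := enorm (grad _ _) in hu hs' g0 *; set v := enorm y.2 in hq hs' v0 *.
rewrite leNgt; apply/negP => lt.
have Cv : 0 <= C * v by rewrite mulr_ge0.
have pos : 0 < (g - C * v) * (g + (C - (uhi - alpha)) * v).
  have : 0 <= (C - (uhi - alpha)) * v by rewrite mulr_ge0// subr_ge0.
  by move=> ?; rewrite mulr_gt0//; lra.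
have : (g - C * v) * (g + (C - (uhi - alpha)) * v)
   = g ^+ 2 - (uhi - alpha) * (g * v) - (C ^+ 2 - (uhi - alpha) * C) * v ^+ 2 by ring.
rewrite C_root; lra.
Qed.

(** The origin of [delta]: [C] accounts for the gradient, and max (uhi, - ulo) bounds |u| on the
    flow set. *)
Lemma enorm_acceleration_le y : 0 < dissipation f y -> flow_set f alpha ulo uhi y ->
  enorm (- grad f y.1 - feedback f alpha y *: y.2) <= delta * enorm y.2.
Proof.
move=> s0 hy; rewrite (le_trans (ler_enormD _ _))// !enormN enormZ /delta mulrDl lerD//.
  exact: enorm_grad_le_velocity.
rewrite ler_wpM2r ?enorm_ge0//; case: hy => _ /andP[h1 h2].
by rewrite ler_norml lerNl !le_max h2 lerN2 h1 orbT.
Qed.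

Section Arc.
Variables (a b : R) (X : R -> 'rV[R]_n * 'rV[R]_n).
Hypothesis hX : flow_arc f alpha ulo uhi a b X.
Hypothesis s0 : 0 < dissipation f (X a).

Lemma flow_arc_dissipation_gt0 s : a <= s <= b -> 0 < dissipation f (X s).
Proof.
by move=> asb; rewrite (@flow_arc_dissipation_at _ _ _ _ _ _ hsmooth _ _ _ _ hX)//
  mulr_gt0 ?expR_gt0.
Qed.

Lemma flow_arc_acceleration_le s : a < s < b ->
  enorm (- grad f (X s).1 - feedback f alpha (X s) *: (X s).2) <= delta * enorm (X s).2.
Proof.
move=> sab; apply: enorm_acceleration_le; last by case: hX => _ _; exact.
by apply: flow_arc_dissipation_gt0; case/andP: sab => ? ?; rewrite !ltW.
Qed.

Lemma flow_arc_grad_le : a < b -> enorm (grad f (X b).1) <= C * enorm (X b).2.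
Proof.
move=> ab; rewrite -subr_ge0; case: (hX) => cX _ sX.
apply: (@left_limit_ge0 R (fun s => C * enorm (X s).2 - enorm (grad f (X s).1)) a b) => //.
  apply: (@within_continuous_comp R _ _ _
    (fun y : 'rV[R]_n * 'rV[R]_n => C * enorm y.2 - enorm (grad f y.1)) X) => // y.
  apply: cvgB.
    apply: (@cvgM _ _ (nbhs y) _ (fun=> C) (fun z : 'rV[R]_n * 'rV[R]_n => enorm z.2)).
      exact: cvg_cst.
    by apply: (@continuous_comp _ _ _ snd (@enorm R n));
      [exact: cvg_snd|exact: enorm_continuous].
  apply: (@continuous_comp _ _ _ (fun z : 'rV[R]_n * 'rV[R]_n => grad f z.1) (@enorm R n)).
    exact: grad_fst_continuous.
  exact: enorm_continuous.
move=> s sab; rewrite subr_ge0; apply: enorm_grad_le_velocity; last exact: sX.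
by apply: flow_arc_dissipation_gt0; case/andP: sab => ? ?; rewrite !ltW.
Qed.

(** Gronwall for |x2|^2, since |x2| itself need not be differentiable where it vanishes. *)
Lemma flow_arc_velocity_le_endpoint : a <= b ->
  enorm (X b).2 <= enorm (X a).2 * expR (delta * (b - a)).
Proof.
move=> ab; case: (hX) => cX _ _.
pose v2 s := dotv (X s).2 (X s).2.
pose h s := v2 s * expR (- (2 * delta) * (s - a)).
have dv s : a < s < b -> is_derive s (1 : R) v2
    (2 * dotv (X s).2 (- grad f (X s).1 - feedback f alpha (X s) *: (X s).2)).
  move=> sab; have d2 := is_derive_coord (flow_arc_derive2 hX sab).
  have := is_derive_dotv d2 d2; move/is_derive_eq; apply.
  by rewrite dotvC; lra.
have : h b <= h a.
  apply: (@nonincreasing_endpoints _ h (fun s =>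
    v2 s * (- (2 * delta) * expR (- (2 * delta) * (s - a)))
    + expR (- (2 * delta) * (s - a)) *
      (2 * dotv (X s).2 (- grad f (X s).1 - feedback f alpha (X s) *: (X s).2)))) => //.
  - move=> s; apply: cvgM; last exact: expR_affine_continuous.
    apply: (@within_continuous_comp R _ _ _
      (fun y : 'rV[R]_n * 'rV[R]_n => dotv y.2 y.2) X) => // y.
    by apply: cvg_dotv; exact: cvg_snd.
  - by move=> s sab; exact: is_deriveM (dv s sab) (is_derive_expR_affine _ _ _).
  - move=> s sab; set e := expR _.
    have e0 : 0 <= e by exact: expR_ge0.
    set w := - grad f _ - _.
    have hw : dotv (X s).2 w <= delta * v2 s.
      rewrite (le_trans (dotv_le_enorm _ _))// /v2 -enorm_sqr expr2 mulrCA.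
      by rewrite ler_wpM2l ?enorm_ge0// flow_arc_acceleration_le.
    by have := ler_wpM2l e0 hw; lra.
rewrite /h subrr mulr0 expR0 mulr1 => hle.
rewrite -(@ler_pXn2r _ 2) ?nnegrE ?mulr_ge0 ?enorm_ge0 ?expR_ge0//.
rewrite exprMn !enorm_sqr [expR _ ^+ 2]expr2 -expRD.
rewrite -(@ler_pM2r _ (expR (- (2 * delta) * (b - a)))) ?expR_gt0// -mulrA -expRD.
by rewrite [X in _ <= _ * expR X](_ : _ = 0) ?expR0 ?mulr1//; ring.
Qed.

End Arc.

Lemma flow_arc_velocity_le a b X s : flow_arc f alpha ulo uhi a b X ->
  0 < dissipation f (X a) -> a <= s <= b ->
  enorm (X s).2 <= enorm (X a).2 * expR (delta * (s - a)).
Proof.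
move=> hX s0 /andP[as' sb].
exact: flow_arc_velocity_le_endpoint (flow_arc_sub (lexx a) sb hX) s0 as'.
Qed.

Lemma flow_arc_velocity_dist a b X : flow_arc f alpha ulo uhi a b X ->
  0 < dissipation f (X a) -> a <= b ->
  enorm ((X b).2 - (X a).2) <= enorm (X a).2 * (expR (delta * (b - a)) - 1).
Proof.
move=> hX s0 ab; case: (hX) => cX _ _; set V := enorm (X a).2.
have -> : V * (expR (delta * (b - a)) - 1)
    = V * expR (delta * (b - a)) - V * expR (delta * (a - a)).
  by rewrite subrr mulr0 expR0; ring.
apply: (@vector_mean_value _ _ (snd \o X)
  (fun s => - grad f (X s).1 - feedback f alpha (X s) *: (X s).2)
  (fun s => V * expR (delta * (s - a))) (fun s => V * (delta * expR (delta * (s - a))))) => //.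
- by apply: within_continuous_comp => // y; exact: cvg_snd.
- by move=> s; apply: cvgM; [exact: cvg_cst|exact: expR_affine_continuous].
- by move=> s sab; exact: is_derive_coord (flow_arc_derive2 hX sab).
- by move=> s _; have := is_deriveZ V (is_derive_expR_affine delta a s).
- move=> s sab; rewrite (le_trans (flow_arc_acceleration_le hX s0 sab))// mulrCA.
  rewrite ler_wpM2l ?(ltW delta_gt0)//; apply: (flow_arc_velocity_le hX) => //.
  by case/andP: sab => ? ?; rewrite !ltW.
Qed.

(** Integrating the exponential speed bound leaves a factor 1 / delta, the source of [delta^-1] in
    the final constants. *)
Lemma flow_arc_position_dist a b X : flow_arc f alpha ulo uhi a b X ->
  0 < dissipation f (X a) -> a <= b ->
  enorm ((X b).1 - (X a).1) <= enorm (X a).2 * delta^-1 * (expR (delta * (b - a)) - 1).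
Proof.
move=> hX s0 ab; case: (hX) => cX _ _; set V := enorm (X a).2 * delta^-1.
have -> : V * (expR (delta * (b - a)) - 1)
    = V * expR (delta * (b - a)) - V * expR (delta * (a - a)).
  by rewrite subrr mulr0 expR0; ring.
apply: (@vector_mean_value _ _ (fst \o X) (fun s => (X s).2)
  (fun s => V * expR (delta * (s - a))) (fun s => V * (delta * expR (delta * (s - a))))) => //.
- by apply: within_continuous_comp => // y; exact: cvg_fst.
- by move=> s; apply: cvgM; [exact: cvg_cst|exact: expR_affine_continuous].
- by move=> s sab; exact: is_derive_coord (flow_arc_derive1 hX sab).
- by move=> s _; have := is_deriveZ V (is_derive_expR_affine delta a s).
- move=> s sab; rewrite mulrA mulfVK ?gt_eqF//; apply: (flow_arc_velocity_le hX) => //.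
  by case/andP: sab => ? ?; rewrite !ltW.
Qed.

End Growth.

Lemma quadratic_root_bound (R : realType) (k L : R) : 0 <= k -> 0 <= L ->
  let C := (k + Num.sqrt (k ^+ 2 + 4 * L)) / 2 in k <= C /\ C ^+ 2 = k * C + L.
Proof.
move=> k0 L0 C; set q := Num.sqrt _ in C *.
have hq : q ^+ 2 = k ^+ 2 + 4 * L by rewrite sqr_sqrtr// addr_ge0 ?sqr_ge0// mulr_ge0.
split.
  have : k <= q by rewrite -[leLHS]ger0_norm// -sqrtr_sqr ler_wsqrtr// lerDl mulr_ge0.
  rewrite /C; lra.
have -> : L = (q ^+ 2 - k ^+ 2) / 4 by rewrite hq; field.
by rewrite /C; field.
Qed.

(** * Drift of the feedback away from its value at the reset *)

Section Drift.
Variables (R : realType) (n : nat) (f : 'rV[R]_n -> R).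
Variables (alpha beta ulo uhi lf Lf Hf : R).
Hypothesis alpha_gt0 : 0 < alpha.
Hypothesis beta_gt0 : 0 < beta.
Hypothesis hsmooth : twice_differentiable f.
Hypothesis lf_ge0 : 0 <= lf.
Hypothesis Lf_ge0 : 0 <= Lf.
Hypothesis Hf_ge0 : 0 <= Hf.
Hypothesis hhess : forall p : 'rV[R]_n,
  loewner_le (- lf)%:M (hess f p) /\ loewner_le (hess f p) Lf%:M.
Hypothesis hhessLip : forall p q : 'rV[R]_n,
  opnorm2 (hess f p - hess f q) <= Hf * enorm (p - q).
Hypothesis huhi : alpha + beta^-1 + lf * beta < uhi.

Variables C delta : R.
Hypothesis C_ge0 : 0 <= C.
Hypothesis C_ge : uhi - alpha <= C.
Hypothesis C_root : C ^+ 2 = (uhi - alpha) * C + Lf.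
Hypothesis deltaE : delta = C + Num.max uhi (- ulo).
Let a2 (r : R) := r * Lf * delta^-1 * (r * beta * C + 1) + beta^-1
                  + (r ^+ 2 + r + 1) * beta * Num.max lf Lf.
Let a3 (r : R) := r ^+ 3 * beta ^+ 2 * Hf * delta^-1.

Let uhi_gap : beta^-1 + lf * beta <= uhi - alpha.
Proof. by have := huhi; lra. Qed.

Let gap_gt0 : 0 < uhi - alpha.
Proof.
apply: lt_le_trans uhi_gap; rewrite ltr_wpDr ?invr_gt0//.
by rewrite mulr_ge0// ltW.
Qed.

Let uhi_ge : alpha <= uhi.
Proof. by rewrite -subr_ge0 ltW. Qed.

Lemma delta_ge : uhi <= delta.
Proof.
have : uhi <= Num.max uhi (- ulo) by rewrite le_max lexx.
by rewrite deltaE; have := C_ge0; lra.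
Qed.

Lemma delta_gt0 : 0 < delta.
Proof. by apply: lt_le_trans delta_ge; have := gap_gt0; have := alpha_gt0; lra. Qed.

(** Here delta >= C + uhi >= 2 (uhi - alpha) + alpha, and uhi - alpha >= 1 / beta + lf beta. This is
    the slack exploited when lf > Lf. *)
Let beta_delta_ge : 2 + alpha * beta + 2 * lf * beta ^+ 2 <= beta * delta.
Proof.
have bb : beta * beta^-1 = 1 by rewrite divff ?gt_eqF.
have : alpha + 2 * beta^-1 + 2 * (lf * beta) <= delta.
  have : uhi <= Num.max uhi (- ulo) by rewrite le_max lexx.
  by rewrite deltaE; have := C_ge; have := uhi_gap; lra.
by rewrite -(ler_pM2l beta_gt0); lra.
Qed.

Lemma a2_gt0 r : 1 < r -> 0 < a2 r.
Proof.
move=> r1; have r0 : 0 <= r by lra.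
have b0 := ltW beta_gt0; have d0 : 0 <= delta^-1 by rewrite invr_ge0 (ltW delta_gt0).
have M0 : 0 <= Num.max lf Lf by rewrite le_max lf_ge0.
have t1 : 0 <= r * Lf * delta^-1 * (r * beta * C + 1).
  by apply: mulr_ge0; [rewrite !mulr_ge0|rewrite addr_ge0// !mulr_ge0].
have t2 : 0 <= (r ^+ 2 + r + 1) * beta * Num.max lf Lf.
  by rewrite !mulr_ge0// !addr_ge0// exprn_ge0.
by rewrite /a2; have := beta_gt0; rewrite -invr_gt0; lra.
Qed.

Lemma a3_ge0 r : 1 < r -> 0 <= a3 r.
Proof.
move=> r1; have r0 : 0 <= r by lra.
by rewrite !mulr_ge0 ?exprn_ge0 ?invr_ge0// ?(ltW beta_gt0)// (ltW delta_gt0).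
Qed.

(** At x2 = - beta grad f, u equals alpha + 1 / beta - beta q, with q the Rayleigh quotient of the
    Hessian at the gradient, which lies in [-lf, Lf]. The constant a1 measures the distance from
    these extreme values to [uhi] and [ulo]. *)
Lemma feedback_reset p : grad f p != 0 ->
  alpha + beta^-1 - Lf * beta <= feedback f alpha (p, - beta *: grad f p)
  <= alpha + beta^-1 + lf * beta.
Proof.
move=> g0; have N0 : 0 < enorm (grad f p) ^+ 2 by rewrite exprn_gt0 ?enorm_gt0.
have hq := hess_quad_bounds hhess p (grad f p).
rewrite /feedback /= -scalemxAl !dotvE -enorm_sqr.
set N := enorm _ ^+ 2 in N0 hq *; set Q := dotv _ _ in hq *.
have -> : alpha + (N - - beta * (- beta * Q)) / (- (- beta * N))
    = alpha + beta^-1 - beta * (Q / N).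
  by field; rewrite !gt_eqF.
have /andP[h1 h2] : - lf <= Q / N <= Lf.
  by rewrite ler_pdivrMr// ler_pdivlMr.
have := ler_wpM2l (ltW beta_gt0) h1; have := ler_wpM2l (ltW beta_gt0) h2.
by move=> ? ?; apply/andP; split; lra.
Qed.

Lemma dissipation_reset p :
  dissipation f (p, - beta *: grad f p) = beta * enorm (grad f p) ^+ 2.
Proof. by rewrite /dissipation /= !dotvE enorm_sqr; ring. Qed.

Lemma a2_homo E r : 0 <= E -> E <= r -> a2 E <= a2 r.
Proof.
move=> E0 Er; have r0 := le_trans E0 Er.
have b0 := ltW beta_gt0; have d0 : 0 <= delta^-1 by rewrite invr_ge0 (ltW delta_gt0).
have M0 : 0 <= Num.max lf Lf by rewrite le_max lf_ge0.
rewrite /a2 !lerD//.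
  apply: ler_pM; rewrite ?addr_ge0 ?mulr_ge0 ?lerD2r//.
    by rewrite ler_wpM2r// ler_wpM2r.
  by rewrite ler_wpM2r// ler_wpM2r.
by rewrite ler_wpM2r// ler_wpM2r// !lerD// lerXn2r.
Qed.

Lemma a3_homo E r : 0 <= E -> E <= r -> a3 E <= a3 r.
Proof.
move=> E0 Er; have d0 : 0 <= delta^-1 by rewrite invr_ge0 (ltW delta_gt0).
rewrite /a3 ler_wpM2r// ler_wpM2r// ler_wpM2r ?exprn_ge0 ?(ltW beta_gt0)//.
by rewrite lerXn2r// nnegrE (le_trans E0).
Qed.

(** The difference of feedbacks is a numerator over beta N^2, the value of sigma at the reset. Its
    terms are of order N^2 and end up in [a2], except the change of Hessian, of order N^3, which
    leaves the factor N beside [a3]. *)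
Lemma feedback_drift a b (X : R -> 'rV[R]_n * 'rV[R]_n) p :
  flow_arc f alpha ulo uhi a b X -> a < b ->
  X a = (p, - beta *: grad f p) -> grad f p != 0 ->
  let E := expR (delta * (b - a)) in
  (`|feedback f alpha (X b) - feedback f alpha (X a)|
  <= (E - 1) * (a2 E + a3 E * enorm (grad f p)) : Prop).
Proof.
move=> hX ab Xa g0 E; have ab' := ltW ab.
have b0 := ltW beta_gt0; have d0 := delta_gt0.
have u0 : 0 <= delta^-1 by rewrite invr_ge0 (ltW d0).
pose N := enorm (grad f p); have N0 : 0 < N by rewrite enorm_gt0.
pose M := Num.max lf Lf; have M0 : 0 <= M by rewrite le_max lf_ge0.
pose ea := expR (alpha * (b - a)).
have sa : dissipation f (X a) = beta * N ^+ 2 by rewrite Xa dissipation_reset.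
have sa0 : 0 < dissipation f (X a) by rewrite sa mulr_gt0// exprn_gt0.
have sb : dissipation f (X b) = beta * N ^+ 2 / ea.
  by rewrite (flow_arc_dissipation hsmooth hX)// sa mulNr expRN.
have ba0 : 0 <= b - a by rewrite subr_ge0.
have da : alpha <= delta by apply: le_trans delta_ge; exact: uhi_ge.
have ea1 : 1 <= ea by rewrite -(@expR0 R) ler_expR mulr_ge0// ltW.
have eaE : ea <= E by rewrite ler_expR ler_wpM2r.
have eath : delta * (ea - 1) <= alpha * (E - 1).
  by apply: expR_sub1_mono => //; rewrite da (ltW alpha_gt0).
have d0' : 0 < C + Num.max uhi (- ulo) by rewrite -deltaE.
have V : enorm (X a).2 = beta * N.
  by rewrite Xa /= enormZ normrN ger0_norm.
have xb := flow_arc_velocity_le_endpoint hsmooth hhess C_ge0 C_ge C_root uhi_ge hX sa0 ab'.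
have dx2 := flow_arc_velocity_dist hsmooth hhess C_ge0 C_ge C_root uhi_ge d0' hX sa0 ab'.
have dx1 := flow_arc_position_dist hsmooth hhess C_ge0 C_ge C_root uhi_ge d0' hX sa0 ab'.
have gb := flow_arc_grad_le hsmooth hhess C_ge0 C_ge C_root uhi_ge hX sa0 ab.
rewrite -deltaE -/E V in xb dx1 dx2.
have dg := grad_lipschitz hsmooth hhess (X a).1 (X b).1 lf_ge0.
have dH := hhessLip (X b).1 (X a).1.
have hq := norm_hess_quad_le hhess (X a).1.
pose Qb := dotv ((X b).2 *m hess f (X b).1) (X b).2.
pose Qm := dotv ((X b).2 *m hess f (X a).1) (X b).2.
pose Qa := dotv ((X a).2 *m hess f (X a).1) (X a).2.
pose G := enorm (grad f (X b).1).
have G0 : 0 <= G by exact: enorm_ge0.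
have Na : enorm (grad f (X a).1) = N by rewrite Xa.
have E1 : 1 <= E by exact: le_trans eaE.
have e0 : 0 <= E - 1 by rewrite subr_ge0.
have E0 : 0 <= E by exact: expR_ge0.
have D : enorm (grad f (X b).1 - grad f (X a).1) <= N * (M * beta * delta^-1 * (E - 1)).
  rewrite (le_trans dg)// -/M (le_trans (ler_wpM2l M0 dx1))//.
  by rewrite le_eqVlt; apply/orP; left; apply/eqP; ring.
have hG1 : G <= N + enorm (grad f (X b).1 - grad f (X a).1).
  by rewrite -Na /G -[X in enorm X <= _](subrKC (grad f (X a).1)); exact: ler_enormD.
have hG2 : N <= G + enorm (grad f (X b).1 - grad f (X a).1).
  rewrite -Na /G -(enormN (_ - _)) opprB -[X in enorm X <= _](subrKC (grad f (X b).1)).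
  exact: ler_enormD.
have hGN : `|G ^+ 2 - N ^+ 2| <= N * (M * beta * delta^-1 * (E - 1)) * (G + N).
  rewrite subr_sqr normrM (ger0_norm (addr_ge0 G0 (ltW N0))) ler_wpM2r ?addr_ge0 ?(ltW N0)//.
  by rewrite ler_norml; apply/andP; split; lra.
have hGC : G <= beta * C * E * N.
  rewrite (le_trans gb)// (le_trans (ler_wpM2l C_ge0 xb))//.
  by rewrite le_eqVlt; apply/orP; left; apply/eqP; ring.
have hQ1 : `|Qb - Qm| <= Hf * (beta * N * delta^-1 * (E - 1)) * (beta * N * E) ^+ 2.
  have -> : Qb - Qm = dotv ((X b).2 *m (hess f (X b).1 - hess f (X a).1)) (X b).2.
    by rewrite mulmxBr !dotvE.
  rewrite (le_trans (norm_dotv_le _ _))//.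
  have v0 := enorm_ge0 (X b).2.
  rewrite (le_trans (ler_wpM2r v0 (enorm_mulmx_le _ _)))// -[leLHS]mulrA -expr2.
  apply: ler_pM; rewrite ?sqr_ge0//.
  - exact: opnorm2_ge0.
  - by rewrite (le_trans dH)// ler_wpM2l.
  - by rewrite lerXn2r ?nnegrE ?mulr_ge0 ?(ltW N0).
have hQ2 : `|Qm - Qa| <= M * beta ^+ 2 * ((E - 1) * (E + 1)) * N ^+ 2.
  apply: (le_trans (quad_form_dist hq _ _)); rewrite -/M.
  rewrite [leRHS](_ : _ = M * ((beta * N * (E - 1)) * (beta * N * E + beta * N)));
    last by ring.
  apply: ler_wpM2l => //; apply: ler_pM => //; [exact: enorm_ge0|exact: enorm_ge0|].
  by apply: (le_trans (ler_enormD _ _)); rewrite V lerD2r.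
have hQa : `|Qa| <= M * beta ^+ 2 * N ^+ 2.
  by apply: (le_trans (hq _)); rewrite V exprMn mulrA.
have N_neq0 : N != 0 by rewrite gt_eqF.
(* The ratio is bounded both by |grad f| <= C |x2| and by the Lipschitz gradient; each bound serves
   one case of the coefficient estimate. *)
have gain0 : 0 <= G / N by rewrite divr_ge0 ?(ltW N0).
have gainC : G / N <= beta * C * E by rewrite ler_pdivrMr.
have gainD : G / N <= 1 + M * beta * delta^-1 * (E - 1).
  by rewrite ler_pdivrMr// mulrDl mul1r (mulrC _ N) (le_trans hG1)// lerD2l.
have eaE' : 1 <= ea <= E by rewrite ea1.
have coef := feedback_drift_coefficient alpha_gt0 beta_gt0 d0 lf_ge0 Lf_ge0 C_ge0
  eaE' eath beta_delta_ge gain0 gainC gainD.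
have N20 : 0 <= N ^+ 2 by exact: sqr_ge0.
have {coef} := ler_wpM2r N20 coef.
rewrite -/M -/(a2 E) => coef.
have P : 0 < beta * N ^+ 2 by rewrite mulr_gt0// exprn_gt0.
have uE : feedback f alpha (X b) - feedback f alpha (X a)
    = (ea * (G ^+ 2 - N ^+ 2) + (ea - 1) * N ^+ 2 - ea * (Qb - Qm) - ea * (Qm - Qa)
       - (ea - 1) * Qa) / (beta * N ^+ 2).
  have fE y : feedback f alpha y =
    alpha + (enorm (grad f y.1) ^+ 2 - dotv (y.2 *m hess f y.1) y.2) / dissipation f y by [].
  rewrite !fE sa sb Na; apply: feedback_drift_split; first by rewrite gt_eqF.
  by rewrite gt_eqF ?expR_gt0.
rewrite uE normrM normfV (gtr0_norm P) ler_pdivrMr//.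
have -> : (E - 1) * (a2 E + a3 E * N) * (beta * N ^+ 2) = beta * (E - 1) * a2 E * N ^+ 2
    + E * (Hf * (beta * N * delta^-1 * (E - 1)) * (beta * N * E) ^+ 2).
  by rewrite /a3; ring.
apply: (ler_norm_drift ea1 eaE N20 hGN hQ1 hQ2 hQa); apply: le_trans coef.
have {1}-> : G = G / N * N by rewrite divfK.
rewrite le_eqVlt; apply/orP; left; apply/eqP; ring.
Qed.

End Drift.

(** * From the drift bound to the dwell time *)

Section Dwell.
Variables (R : realType) (n : nat) (f : 'rV[R]_n -> R).
Variables (alpha beta ulo uhi lf Lf Hf C delta : R).
Hypothesis alpha_gt0 : 0 < alpha.
Hypothesis beta_gt0 : 0 < beta.
Hypothesis hsmooth : twice_differentiable f.
Hypothesis lf_ge0 : 0 <= lf.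
Hypothesis Lf_ge0 : 0 <= Lf.
Hypothesis Hf_ge0 : 0 <= Hf.
Hypothesis hhess : forall p : 'rV[R]_n,
  loewner_le (- lf)%:M (hess f p) /\ loewner_le (hess f p) Lf%:M.
Hypothesis hhessLip : forall p q : 'rV[R]_n,
  opnorm2 (hess f p - hess f q) <= Hf * enorm (p - q).
Hypothesis hulo : ulo < alpha + beta^-1 - Lf * beta.
Hypothesis huhi : alpha + beta^-1 + lf * beta < uhi.
Hypothesis C_ge0 : 0 <= C.
Hypothesis C_ge : uhi - alpha <= C.
Hypothesis C_root : C ^+ 2 = (uhi - alpha) * C + Lf.
Hypothesis deltaE : delta = C + Num.max uhi (- ulo).

Let a1 := Num.min (uhi - (alpha + beta^-1 + lf * beta))
                  ((alpha + beta^-1 - Lf * beta) - ulo).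
Let a2 (r : R) := r * Lf * delta^-1 * (r * beta * C + 1) + beta^-1
                  + (r ^+ 2 + r + 1) * beta * Num.max lf Lf.
Let a3 (r : R) := r ^+ 3 * beta ^+ 2 * Hf * delta^-1.

Let delta_pos : 0 < delta.
Proof. exact: (delta_gt0 alpha_gt0 beta_gt0 lf_ge0 huhi C_ge0 deltaE). Qed.

Let bound r N := ln (Num.min (a1 / (a2 r + a3 r * N) + 1) r `^ (1 / delta)).

Lemma a1_gt0 : 0 < a1.
Proof. by rewrite lt_min !subr_gt0 huhi hulo. Qed.

Let denom_gt0 r N : 1 < r -> 0 <= N -> 0 < a2 r + a3 r * N.
Proof.
move=> r1 N0; apply: ltr_wpDr.
  apply: mulr_ge0 => //.
  exact: (a3_ge0 alpha_gt0 beta_gt0 lf_ge0 Hf_ge0 huhi C_ge0 deltaE r1).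
exact: (a2_gt0 alpha_gt0 beta_gt0 lf_ge0 Lf_ge0 huhi C_ge0 deltaE r1).
Qed.

Let min_gt1 r N : 1 < r -> 0 <= N -> 1 < Num.min (a1 / (a2 r + a3 r * N) + 1) r.
Proof.
move=> r1 N0; rewrite lt_min r1 andbT ltrDr.
by apply: divr_gt0; [exact: a1_gt0|exact: denom_gt0].
Qed.

Lemma dwell_bound_gt0 r N : 1 < r -> 0 <= N -> 0 < bound r N.
Proof.
move=> r1 N0; rewrite /bound ln_powR mulr_gt0 ?divr_gt0//.
by apply: ln_gt0; exact: min_gt1.
Qed.

(** A common bound on the gradients at the resets thus yields a common dwell time. *)
Lemma dwell_bound_antitone r N N' : 1 < r -> 0 <= N -> N <= N' ->
  bound r N' <= bound r N.
Proof.
move=> r1 N0 NN'; have N0' := le_trans N0 NN'.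
rewrite /bound !ln_powR; apply: ler_wpM2l; first by rewrite divr_ge0 ?(ltW delta_pos).
rewrite ler_ln ?posrE; [|exact: lt_trans ltr01 (min_gt1 _ _)..].
rewrite le_min ge_min ge_min lexx orbT andbT; apply/orP; left.
rewrite lerD2r; apply: ler_wpM2l; first exact: ltW a1_gt0.
rewrite lef_pV2 ?posrE; [|exact: denom_gt0..].
rewrite lerD2l; apply: ler_wpM2l => //.
exact: (a3_ge0 alpha_gt0 beta_gt0 lf_ge0 Hf_ge0 huhi C_ge0 deltaE r1).
Qed.

(** If the arc were shorter, u would have moved by less than a1 and sigma would still be positive,
    so the final state would be interior. *)
Lemma dwell_time a b (X : R -> 'rV[R]_n * 'rV[R]_n) p r :
  flow_arc f alpha ulo uhi a b X -> a <= b -> X a = (p, - beta *: grad f p) ->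
  grad f p != 0 -> ~ interior (flow_set f alpha ulo uhi) (X b) -> 1 < r ->
  bound r (enorm (grad f p)) <= b - a.
Proof.
move=> hX ab Xa g0 hXb r1.
have N0 := enorm_ge0 (grad f p).
have Np : 0 < enorm (grad f p) ^+ 2 by rewrite exprn_gt0 ?enorm_gt0.
have sa0 : 0 < dissipation f (X a) by rewrite Xa dissipation_reset mulr_gt0.
have /andP[ua1 ua2] := feedback_reset alpha beta_gt0 hhess g0; rewrite -Xa in ua1 ua2.
move: ab; rewrite le_eqVlt => /predU1P[ab|ab].
  (* A state just after a reset is interior, so an arc that starts there cannot have length zero. *)
  exfalso; apply: hXb; rewrite -ab.
  apply: (interior_flow_set hsmooth hhessLip); first by rewrite gt_eqF.
  by apply/andP; split; [exact: lt_le_trans hulo ua1|exact: le_lt_trans ua2 huhi].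
rewrite leNgt; apply/negP => short; apply: hXb.
have ab' := ltW ab.
set E := expR (delta * (b - a)).
have E0 : 0 <= E by exact: expR_ge0.
have E1 : 1 <= E by rewrite -(@expR0 R) ler_expR mulr_ge0 ?subr_ge0// ltW.
have : E < Num.min (a1 / (a2 r + a3 r * enorm (grad f p)) + 1) r.
  have m0 := lt_trans ltr01 (min_gt1 r1 N0).
  rewrite -[ltRHS]lnK ?posrE// ltr_expR mulrC -ltr_pdivlMr//.
  by rewrite /bound ln_powR mulrC div1r in short.
rewrite lt_min -ltrBlDr ltr_pdivlMr ?denom_gt0// => /andP[Ea1 /ltW Er].
have drift := feedback_drift alpha_gt0 beta_gt0 hsmooth lf_ge0 Lf_ge0 Hf_ge0 hhess
  hhessLip huhi C_ge0 C_ge C_root deltaE hX ab Xa g0.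
have {drift} drift : `|feedback f alpha (X b) - feedback f alpha (X a)| < a1.
  apply: le_lt_trans drift _; apply: le_lt_trans Ea1.
  rewrite ler_wpM2l ?subr_ge0// lerD//.
    exact: (a2_homo alpha_gt0 beta_gt0 lf_ge0 Lf_ge0 huhi C_ge0 deltaE E0 Er).
  rewrite ler_wpM2r//.
  exact: (a3_homo alpha_gt0 beta_gt0 lf_ge0 Hf_ge0 huhi C_ge0 deltaE E0 Er).
move: drift; rewrite lt_min !ltr_norml => /andP[/andP[_ d1] /andP[d2 _]].
apply: (interior_flow_set hsmooth hhessLip).
  rewrite -/(dissipation f (X b)) (flow_arc_dissipation hsmooth hX ab').
  by rewrite gt_eqF// mulr_gt0// expR_gt0.
by apply/andP; split; lra.
Qed.

End Dwell.

(** * Arcs between consecutive jumps of a hybrid solution *)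

Section HybridArcs.
Variables (R : realType) (n : nat) (f : 'rV[R]_n -> R) (alpha beta ulo uhi : R).
Variables (t : nat -> \bar R) (x : nat -> R -> 'rV[R]_n * 'rV[R]_n).
Hypothesis hsol : hybrid_solution f alpha beta ulo uhi t x.

Lemma jump_time_ge0 j : (0 <= t j)%E.
Proof.
case: hsol => t0 tmono _ _; elim: j => [|j IH]; first by rewrite t0.
exact: le_trans IH (tmono j).
Qed.

Lemma jump_time_pred_fin j T : t j.+1 = T%:E -> exists2 S, t j = S%:E & S <= T.
Proof.
case: hsol => _ tmono _ _ tT; have := jump_time_ge0 j; have := tmono j; rewrite tT.
by case: (t j) => [S| |]// ST _; exists S.
Qed.

Lemma hybrid_flow_arc j a b : t j = a%:E -> t j.+1 = b%:E ->
  flow_arc f alpha ulo uhi a b (x j).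
Proof.
case: hsol => _ _ /(_ j)[cx dx ix] _ ta tb; rewrite ta tb in cx dx ix; split.
- have -> // : [set` `[a, b]] = [set s : R | (a%:E <= s%:E <= b%:E)%E].
  by apply/seteqP; split=> s /=; rewrite in_itv/= !lee_fin.
- by move=> s sab; apply: dx; rewrite !lte_fin.
- move=> s /andP[sa sb]; apply: interior_subset; apply: ix.
  by rewrite lee_fin lte_fin ltW.
Qed.

End HybridArcs.

Theorem theorem3p2 (R : realType) (n : nat) (f : 'rV[R]_n -> R)
    (alpha fstar lf Lf muf Hf ulo uhi beta : R)
    (halpha : 0 < alpha)
    (hsmooth : twice_differentiable f)
    (hmin : exists p : 'rV[R]_n, f p = fstar)
    (hfstar : forall p : 'rV[R]_n, fstar <= f p)
    (hlf : 0 <= lf) (hLf : 0 <= Lf) (hmuf : 0 < muf) (hHf : 0 < Hf)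
    (hhess : forall p : 'rV[R]_n,
       loewner_le (- lf)%:M (hess f p) /\ loewner_le (hess f p) Lf%:M)
    (hPL : forall p : 'rV[R]_n,
       muf * (f p - fstar) <= 2^-1 * enorm (grad f p) ^+ 2)
    (hhessLip : forall p q : 'rV[R]_n,
       opnorm2 (hess f p - hess f q) <= Hf * enorm (p - q))
    (hulo : ulo < alpha + beta^-1 - Lf * beta)
    (huhi : alpha + beta^-1 + lf * beta < uhi)
    (hbeta : alpha <= 2 * muf * beta)
    (t : nat -> \bar R) (x : nat -> R -> 'rV[R]_n * 'rV[R]_n)
    (hsol : hybrid_solution f alpha beta ulo uhi t x)
    (hx0 : grad f (x 0%N 0).1 != 0) :
  let C := ((uhi - alpha) + Num.sqrt ((uhi - alpha) ^+ 2 + 4 * Lf)) / 2 in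
  let delta := C + Num.max uhi (- ulo) in
  let calLf := Num.max lf Lf in
  let a1 := Num.min (uhi - (alpha + beta^-1 + lf * beta))
                    ((alpha + beta^-1 - Lf * beta) - ulo) in
  let a2 (r : R) := r * Lf * delta^-1 * (r * beta * C + 1) + beta^-1
                    + (r ^+ 2 + r + 1) * beta * calLf in
  let a3 (r : R) := r ^+ 3 * beta ^+ 2 * Hf * delta^-1 in
  (forall (j : nat) (s : R) (p : 'rV[R]_n),
     t j = s%:E -> x j s = (p, - beta *: grad f p) ->
     forall r : R, 1 < r ->
       ((ln (Num.min (a1 / (a2 r + a3 r * enorm (grad f p)) + 1) r
             `^ (1 / delta)))%:E <= t j.+1 - t j)%E) /\
  zeno_free t.
Proof.
move=> C delta calLf a1 a2 a3.
(* Positivity of [beta] comes from 0 < alpha <= 2 muf beta. *)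
have beta0 : 0 < beta.
  have : 0 < 2 * muf * beta by exact: lt_le_trans hbeta.
  by rewrite pmulr_rgt0// mulr_gt0.
have gap : 0 <= uhi - alpha.
  have : 0 <= beta^-1 + lf * beta by rewrite addr_ge0 ?mulr_ge0 ?invr_ge0 ?(ltW beta0).
  lra.
have [C_ge C_root] := quadratic_root_bound gap hLf; rewrite -/C in C_ge C_root.
have C_ge0 : 0 <= C by exact: le_trans C_ge.
have Hf0 := ltW hHf.
case: (hsol) => t0 tmono harc hjump.
have reset j T : t j.+1 = T%:E ->
    x j.+1 T = ((x j T).1, - beta *: grad f (x j T).1).
  by move=> /hjump [_ ->].
have dissip_pos p : grad f p != 0 -> 0 < dissipation f (p, - beta *: grad f p).
  by move=> g0; rewrite dissipation_reset mulr_gt0// exprn_gt0// enorm_gt0.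
have gneq0 y : dissipation f y != 0 -> grad f y.1 != 0.
  by apply: contra_neq => g0; rewrite /dissipation g0 dot0v.
(* The initial state need not be a reset. If the first arc has positive length, it starts in the
   flow set, so sigma is nonzero and stays so; otherwise [hx0] applies. Later arcs start at a reset
   with sigma > 0. *)
have hgrad j T : t j.+1 = T%:E -> grad f (x j T).1 != 0.
  elim: j T => [|j IH] T tT; have [S tS ST] := jump_time_pred_fin hsol tT;
    have hX := hybrid_flow_arc hsol tS tT.
    move: tS; rewrite t0 => -[S0]; rewrite -S0 in ST hX.
    move: ST; rewrite le_eqVlt => /predU1P[<-//|T0].
    apply: gneq0; rewrite (flow_arc_dissipation hsmooth hX (ltW T0)).
    apply: mulf_neq0; last by rewrite gt_eqF ?expR_gt0.
    have [_ _ /(_ 0)] := harc 0%N.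
    by rewrite t0 tT lexx lte_fin => /(_ T0)/interior_subset [].
  apply: gneq0; rewrite (flow_arc_dissipation hsmooth hX ST).
  by rewrite gt_eqF// mulr_gt0 ?expR_gt0// reset// dissip_pos// IH.
have dwell j s p : t j = s%:E -> x j s = (p, - beta *: grad f p) ->
     forall r : R, 1 < r ->
       ((ln (Num.min (a1 / (a2 r + a3 r * enorm (grad f p)) + 1) r
             `^ (1 / delta)))%:E <= t j.+1 - t j)%E.
  move=> ts xs r r1.
  have g0 : grad f p != 0.
    case: j ts xs => [|j] ts xs.
      by move: ts xs hx0; rewrite t0 => -[<-] ->.
    by have := hgrad _ _ ts; move: xs; rewrite reset// => -[->].
  rewrite ts; case E : (t j.+1) => [T| |].
  - rewrite -EFinB lee_fin.
    have [S] := jump_time_pred_fin hsol E; rewrite ts => -[<-] sT.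
    have hX := hybrid_flow_arc hsol ts E.
    exact: (dwell_time halpha beta0 hsmooth hlf hLf Hf0 hhess hhessLip hulo huhi
      C_ge0 C_ge C_root erefl hX sT xs g0 (hjump _ _ E).1 r1).
  - by rewrite addye// leey.
  - by have := tmono j; rewrite E ts.
split=> //.
(* [t j.+1] ends the arc of index [j]; only arcs 1 to j start at a reset, hence j dwell times. *)
have [tau tau0 htau] : exists2 tau, 0 < tau & forall j, ((j%:R * tau)%:E <= t j.+1)%E.
  case E1 : (t 1%N) => [T1| |]; last 2 first.
  - exists 1 => // j; suff -> : t j.+1 = +oo%E by rewrite leey.
    by elim: j => [//|j IH]; apply/eqP; rewrite -leye_eq -IH.
  - by have := jump_time_ge0 hsol 1; rewrite E1.
  (* The reference level is taken at the first jump: sigma may be negative on the initial arc, along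
     which f then increases. *)
  have hdesc j T : t j.+1 = T%:E -> f (x j T).1 <= f (x 0%N T1).1.
    elim: j T => [|j IH] T tT; first by move: tT; rewrite E1 => -[->].
    have [S tS ST] := jump_time_pred_fin hsol tT.
    apply: le_trans (IH _ tS).
    have hX := hybrid_flow_arc hsol tS tT.
    apply: le_trans (flow_arc_objective_le hsmooth hX ST _) _; rewrite reset//.
    by apply: dissip_pos; exact: hgrad.
  pose B := Num.sqrt (2 * (Lf + 1) * (f (x 0%N T1).1 - fstar)).
  have hB j T : t j.+1 = T%:E -> enorm (grad f (x j T).1) <= B.
    move=> tT; rewrite -[leLHS]ger0_norm ?enorm_ge0// -sqrtr_sqr ler_wsqrtr//.
    apply: le_trans (grad_sqr_le hsmooth hhess _ hLf hfstar) _.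
    by rewrite ler_wpM2l ?mulr_ge0 ?addr_ge0// lerD2r hdesc.
  have B0 : 0 <= B by exact: sqrtr_ge0.
  have two1 : 1 < 2 :> R by rewrite ltr1n.
  (* Any r > 1 would do; r = 2 is chosen. *)
  exists (ln (Num.min (a1 / (a2 2 + a3 2 * B) + 1) 2 `^ (1 / delta))).
    exact: (dwell_bound_gt0 halpha beta0 hlf hLf Hf0 hulo huhi C_ge0 erefl two1 B0).
  set tau := ln _; elim=> [|j IH]; first by rewrite mul0r (jump_time_ge0 hsol).
  case E : (t j.+1) => [T| |]; last 2 first.
  - have := tmono j.+1; rewrite E leye_eq => /eqP ->; exact: leey.
  - by have := jump_time_ge0 hsol j.+1; rewrite E.
  have := dwell _ _ _ E (reset _ _ E) 2 two1; rewrite E in IH *.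
  have anti : tau <= ln (Num.min (a1 / (a2 2 + a3 2 * enorm (grad f (x j T).1)) + 1) 2
      `^ (1 / delta)).
    exact: (dwell_bound_antitone halpha beta0 hlf hLf Hf0 hulo huhi C_ge0 erefl
      two1 (enorm_ge0 _) (hB _ _ E)).
  case: (t j.+2) => [T'| |]; rewrite ?leey//.
  move: IH; rewrite -EFinB !lee_fin => IH h; rewrite -natr1; lra.
(* A jump no later than [b] has j tau <= b. *)
move=> a b; exists (Num.bound (b / tau)).
apply: subset_card_le => j /andP[_ jb] /=.
rewrite -(ltr_nat R); apply: le_lt_trans (archi_boundP _).
  by have := le_trans (htau j) jb; rewrite lee_fin ler_pdivlMr.
rewrite divr_ge0 ?(ltW tau0)//.
by have := le_trans (jump_time_ge0 hsol j.+1) jb; rewrite lee_fin.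
Qed.
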